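(* Let $p\in\mathbb{R}[x_1,x_2]$ be a bivariate polynomial of degree $m$ with $p(0)=1$, such that the algebraic plane curve $\mathcal{C}=\{x\in\mathbb{R}^2: p(x)=0\}$ has genus zero, i.e. is rationally parametrizable, and let $q_0,q_1,q_2$ be univariate polynomials of degree $m$ giving a rational parametrization $\mathcal{C}=\{x\in\mathbb{R}^2: x_1=q_1(u)/q_0(u),\ x_2=q_2(u)/q_0(u),\ u\in\mathbb{R}\}$. Then the connected component around the origin delimited by the curve $\mathcal{C}$ is rigidly convex if and only if $B(q_1,q_2)\succeq 0$, where $B(q_1,q_2)$ is the $m\times m$ Bézoutian matrix of $q_1$ and $q_2$ and $\succeq 0$ means positive semidefinite.
   Context: Rigid convexity: for a polynomial $p\in\mathbb{R}[x_1,x_2]$ of degree $m$ with $p(0)=1$, the connected component containing the origin of $\{x\in\mathbb{R}^2: p(x)\ge 0\}$ (the component around the origin delimited by the curve $p=0$) is called rigidly convex if $p$ satisfies the real zero condition: for every unit vector $z\in\mathbb{R}^2$, the univariate polynomial $t\mapsto p(tz)$ has only real roots. Geometrically, a generic line passing through the origin intersects the curve $p=0$ at $m$ real points. Bézoutian: given two univariate polynomials $g,h$ of the same degree $m$ (if the degrees are not the same, the polynomial of smaller degree is regarded as a degree $m$ polynomial with zero leading coefficients), write $$\frac{g(u)h(v)-g(v)h(u)}{u-v}=\sum_{k=0}^{m-1}\sum_{l=0}^{m-1}b_{kl}u^kv^l .$$ The Bézoutian matrix $B(g,h)$ is the symmetric $m\times m$ matrix with entries $b_{kl}$, $0\le k,l\le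 m-1$.
   Formalization: As u→−u flips the sign of B, the stated iff is proved if q1'q2−q1q2'>0 at some u; for every parametrization, rigidly convex iff B⪰0 or −B⪰0. Genus zero is read as p irreducible with a nonconstant parametrization, which may miss finitely many points. *)

(* Defs.v *)
From HB Require Import structures.
From mathcomp Require Import all_boot all_order all_algebra.
From mathcomp Require Import polyXY complex mpoly.
From mathcomp Require Import boolp classical_sets cardinality reals topology
  normedtype.

Set Implicit Arguments.
Unset Strict Implicit.
Unset Printing Implicit Defensive.

Import Order.TTheory GRing.Theory Num.Theory.
Import numFieldNormedType.Exports.

Local Open Scope ring_scope.
Local Open Scope classical_set_scope.

Section Plane.
Context {R : realType}.
Implicit Types (p : {mpoly R[2]}) (x z : 'rV[R]_2) (S : set 'rV[R]_2).

Definition peval p x : R := p.@[fun i => x 0 i].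

Definition plane_curve p : set 'rV[R]_2 := [set x | peval p x = 0].

Definition origin_component p : set 'rV[R]_2 :=
  connected_component [set x | 0 <= peval p x] 0.

(* The univariate polynomial t |-> p (t z). *)
Definition line_restriction p z : {poly R} :=
  mmap (@polyC R) (fun i => z 0 i *: 'X) p.

Definition real_rooted (f : {poly R}) : Prop :=
  forall t : R[i], root (map_poly (real_complex R) f) t -> complex.Im t = 0.

(* Unit vectors are Euclidean: the library norm on 'rV[R]_2 is the sup norm. *)
Definition real_zero p : Prop :=
  forall z, \sum_i z 0 i ^+ 2 = 1 -> real_rooted (line_restriction p z).

(* Rigid convexity of the component is, by definition, a condition on its
   defining polynomial. *)
Definition rigidly_convex p S : Prop := S = origin_component p /\ real_zero p.

(* Irreducibility in R[x1, x2]. *)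
Definition mirreducible p : Prop :=
  (1 < msize p)%N /\
  forall a b : {mpoly R[2]}, p = a * b -> (msize a <= 1)%N \/ (msize b <= 1)%N.

Implicit Types q : {poly R}.

Definition param_point q0 q1 q2 (u : R) : 'rV[R]_2 :=
  \row_(i < 2) (if i == 0 then q1.[u] / q0.[u] else q2.[u] / q0.[u]).

Definition param_image q0 q1 q2 : set 'rV[R]_2 :=
  [set param_point q0 q1 q2 u | u in [set u | q0.[u] != 0]].

(* A nonconstant rational parametrization over R of the curve p = 0.  As usual
   for rational curves, finitely many real points may be missed: the point of
   parameter u = oo (e.g. one point of any parametrized circle), and isolated
   singular points, whose parameters are not real. *)
Definition rational_parametrization p q0 q1 q2 : Prop :=
  [/\ q0 != 0,
      ~ (exists a b : R, q1 = a *: q0 /\ q2 = b *: q0),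
      param_image q0 q1 q2 `<=` plane_curve p
    & finite_set (plane_curve p `\` param_image q0 q1 q2)].

(* In {poly {poly R}}, 'X stands for u and 'Y = 'X%:P for v, so that g^:P is
   g(u) and g%:P is g(v); the division is exact (bezout_polyE). *)
Definition bezout_poly q q' : {poly {poly R}} :=
  (q^:P * q'%:P - q%:P * q'^:P) %/ ('X - 'Y).

Lemma bezout_polyE q q' :
  bezout_poly q q' * ('X - 'Y) = q^:P * q'%:P - q%:P * q'^:P.
Proof.
apply: Pdiv.IdomainUnit.divpK; first by rewrite lead_coefXsubC unitr1.
have compX (r : {poly R}) : r^:P.['X] = r by exact: comp_polyXr.
by rewrite dvdp_XsubCl rootE !hornerE !compX subrr.
Qed.

(* To be used for polynomials of degree at most m; smaller degrees amount to
   zero leading coefficients. *)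
Definition bezoutian (m : nat) q q' : 'M[R]_m :=
  \matrix_(k < m, l < m) (bezout_poly q q')`_k`_l.

Definition psd (m : nat) (A : 'M[R]_m) : Prop :=
  A^T = A /\ forall v : 'cV[R]_m, 0 <= (v^T *m A *m v) 0 0.

(* The polar angle of (q1(u), q2(u)), which modulo pi is that of the point
   (q1(u) / q0(u), q2(u) / q0(u)), decreases at some parameter u.  Reversing the
   parametrization, u |-> - u, changes the sign of the derivative of that angle,
   and turns the Bezoutian of q1 and q2 into minus a congruent matrix. *)
Definition clockwise q1 q2 : Prop :=
  exists u : R, 0 < (q1^`() * q2 - q1 * q2^`()).[u].

End Plane.

(* Main.v *)
Require Import Defs.
From HB Require Import structures.
From mathcomp Require Import all_boot all_order all_algebra.
From mathcomp Require Import polyXY complex mpoly.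
From mathcomp Require Import boolp classical_sets cardinality reals topology
  normedtype.
From mathcomp Require Import separable polyorder polyrcf perm ring lra zify.

Set Implicit Arguments.
Unset Strict Implicit.
Unset Printing Implicit Defensive.

Import Order.TTheory GRing.Theory Num.Theory.
Import numFieldNormedType.Exports.

Local Open Scope ring_scope.
Local Open Scope classical_set_scope.

(** For a real direction z, the roots of f_z = z_2 q_1 - z_1 q_2 are the
    parameters of the points of the curve on the line R z.  The statement is
    about when all of these points are real.

    The link with B = B(q_1, q_2) is a determinantal formula for p.  The matrix
    B(q_1, q_2) - y B(q_1, q_0) - x B(q_0, q_2) is the Bezoutian of q_1 - x q_0
    and q_2 - y q_0, hence is singular at every parametrized point (x, y).  Its
    determinant N has degree at most m in (x, y), and N(0) = det B does not
    vanish, because q_1 and q_2 have no common root, even at infinity: it would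
    be a parameter of the origin, while p(0) = 1.  An irreducible polynomial
    divides every polynomial that vanishes on its parametrized zero set
    (dvd_of_vanishes_on_param), so N = det B * p (det_pencilE).  The same
    argument with the factors common to q_0, q_1, q_2 removed would give a
    pencil of size less than m; so there are none, and the degree is exactly m
    (top_and_no_common_root).

    If B or - B is positive semidefinite, then it is definite, its determinant
    being nonzero, and p(tz) = det (B - t S) / det B with S real symmetric has
    only real roots (real_zero_of_psd).

    Conversely, if f_z has m distinct roots u_i, the Vandermonde matrix of the
    u_i turns the Bezoutian into the diagonal matrix of the W(u_i), where
    W = q_1' q_2 - q_1 q_2'.  So it is enough that W has a constant sign on R and
    that some f_z has m distinct real roots.  Both follow from the fact that
    q_1(u) / q_2(u) is real for finitely many nonreal u only
    (finitely_many_balanced).  Indeed p(tz) = prod_i (1 - t q_0(u_i) / s_i), with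
    (q_1(u_i), q_2(u_i)) = s_i z.  For such a u, conj(u) is another root of the
    same f_z, and when p(tz) has only real roots both give the same t.  The
    latter is therefore a double root, so that the radial derivative
    x dp/dx + y dp/dy vanishes there; and p, irreducible, does not divide it, so
    it vanishes at finitely many points of the curve only.  Finally, the
    Bezoutian at (u, conj(u)) is Im(q_1(u) conj(q_2(u))) / Im(u), which tends to
    W on the real line: if W took both signs, then by the intermediate value
    theorem on a horizontal line close to R, avoiding the exceptional points,
    q_1 / q_2 would be real at another nonreal point
    (wronskian_sign_constant).

    As W(u) is the value of the quadratic form B at (1, u, ..., u^(m-1)), the
    orientation of the parametrization decides which of B, - B is positive. *)

(** * Gauss's lemma for polynomials in two variables *)

Section GaussLemma.
Context {F : fieldType}.
Implicit Types (c : {poly F}) (D E P : {poly {poly F}}).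

Lemma coefs_dvdp_scale c D :
  (forall i, c %| D`_i) -> exists D', D = c *: D'.
Proof.
move=> cD; exists (\poly_(i < size D) (D`_i %/ c)).
apply/polyP=> i; rewrite coefZ coef_poly.
by case: ltnP => [_|/leq_sizeP->//]; rewrite ?mulr0 // mulrC divpK.
Qed.

(** An irreducible c is prime, so in degree i + j, where i and j are the first
    indices at which D and E have a coefficient not divisible by c, exactly one
    term of the convolution is not divisible by c. *)
Lemma coefs_dvdp_mul c D E : irreducible_poly c ->
  (forall i, c %| (D * E)`_i) ->
  (forall i, c %| D`_i) \/ (forall i, c %| E`_i).
Proof.
move=> irr_c cDE.
have notall (A : {poly {poly F}}) :
    (forall i, c %| A`_i) \/ (exists i, ~~ (c %| A`_i)).
  have [cA|] := boolP [forall i : 'I_(size A), c %| A`_i].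
    left=> i; have [/leq_sizeP->|lti] := leqP (size A) i; rewrite ?dvdp0 //.
    exact: (forallP cA (Ordinal lti)).
  by rewrite negb_forall => /existsP[i ncA]; right; exists i.
have [|exD] := notall D; first by left.
have [|exE] := notall E; first by right.
exfalso.
case: (ex_minnP exD) => i nci mini; case: (ex_minnP exE) => j ncj minj.
have lti : (i < (i + j).+1)%N by rewrite ltnS leq_addr.
have := cDE (i + j)%N; rewrite coefM (bigD1 (Ordinal lti)) //= addKn.
rewrite dvdp_addl; last first.
  elim/big_rec: _ => [|k x ki cx]; first exact: dvdp0.
  apply: dvdp_add => //.
  have [ltki|leik] := ltnP k i.
    by apply: dvdp_mulr; apply: contraTT ltki => /mini; rewrite -leqNgt.
  have ltik : (i < k)%N by rewrite ltn_neqAle leik andbT eq_sym.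
  have ltj : (i + j - k < j)%N.
    by rewrite ltn_subLR ?ltn_add2r // -ltnS.
  by apply: dvdp_mull; apply: contraTT ltj => /minj; rewrite -leqNgt.
by rewrite Gauss_dvdpr ?(negPf ncj) // irreducible_poly_coprime.
Qed.

Lemma scale_polyI c : c != 0 -> injective (fun D : {poly {poly F}} => c *: D).
Proof.
by move=> c0 D E /=; rewrite -!mul_polyC; apply: mulfI; rewrite polyC_eq0.
Qed.

(** Irreducible factors of c divide all coefficients of D or of E, and can be
    cancelled one at a time. *)
Lemma gauss_factor c P D E : c != 0 -> c *: P = D * E ->
  exists a b D' E', [/\ D = a *: D', E = b *: E' & P = D' * E'].
Proof.
have [n] := ubnP (size c); elim: n => // n IHn in c P D E *.
rewrite ltnS => sc c0 cP.
have [sc1|sc1] := leqP (size c) 1.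
  have cE := size1_polyC sc1; have c00 : c`_0 != 0.
    by apply: contra c0; rewrite {2}cE => /eqP->.
  (* A nonzero constant is invertible, and can be absorbed by D. *)
  have cV : c * (c`_0)^-1%:P = 1 by rewrite {1}cE -polyCM divff.
  exists c, 1, ((c`_0)^-1%:P *: D), E; split; rewrite ?scale1r //.
    by rewrite scalerA cV scale1r.
  by rewrite -scalerAl -cP scalerA mulrC cV scale1r.
have [irr_c|nirr] := pselect (irreducible_poly c).
  have /(coefs_dvdp_mul irr_c) : forall i, c %| (D * E)`_i.
    by move=> i; rewrite -cP coefZ dvdp_mulr.
  case=> /coefs_dvdp_scale[D' DE]; [exists c, 1, D', E|exists 1, c, D, D'];
    split; rewrite ?scale1r //; apply: (scale_polyI c0) => /=; rewrite cP DE.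
    by rewrite scalerAl.
  by rewrite scalerAr.
have [q [sq1 qc nqc]] : exists q : {poly F},
    [/\ size q != 1%N, q %| c & ~~ (q %= c)].
  apply: contrapT => nex; apply: nirr; split=> // q sq1 qc.
  by apply: contrapT => /negP nqc; apply: nex; exists q.
have [q0 sq] : q != 0 /\ (size q < size c)%N.
  split; first by apply: contraTneq qc => ->; rewrite dvd0p.
  by rewrite ltn_neqAle dvdp_leq // andbT dvdp_size_eqp.
have cE : c = q * (c %/ q) by rewrite mulrC divpK.
have r0 : c %/ q != 0 by apply: contra c0 => /eqP r0; rewrite cE r0 mulr0.
have sr : (size (c %/ q)%R < size c)%N.
  rewrite size_divp // ltn_subrL size_poly_gt0 c0 andbT -subn1 subn_gt0.
  by rewrite ltn_neqAle eq_sym sq1 size_poly_gt0.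
have : q *: ((c %/ q) *: P) = D * E by rewrite scalerA -cE.
case/(IHn q) => // [|a [b [D1 [E1 [-> -> /IHn]]]]]; first exact: leq_trans sc.
case=> // [|a' [b' [D' [E' [-> -> ->]]]]]; first exact: leq_trans sc.
by exists (a * a'), (b * b'), D', E'; rewrite !scalerA.
Qed.
End GaussLemma.

(** * Polynomials vanishing on a set of points of the plane *)

Section VanishingIdeal.
Context {F : fieldType}.
Variable Z : F -> F -> Prop.
Implicit Types (P G D : {poly {poly F}}).

Definition vanishes P := forall x y, Z x y -> P.[y%:P].[x] = 0.

Definition irreducible_XY P := P != 0 /\
  forall D E, P = D * E -> (exists k, D = k%:P%:P) \/ (exists k, E = k%:P%:P).

Lemma vanishes_modp D G : vanishes D -> vanishes G -> vanishes (G %% D).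
Proof.
move=> vD vG x y Zxy.
have := congr1 (fun P : {poly {poly F}} => P.[y%:P].[x])
  (Pdiv.Idomain.divp_eq G D).
by rewrite !hornerE (vD x y) // (vG x y) // !mulr0 add0r => <-.
Qed.

(** Generator, up to denominators in the inner variable, of the polynomials that
    vanish on Z: pseudo-division by it leaves no remainder. *)
Lemma ex_minimal_vanishing P : P != 0 -> vanishes P ->
  exists D, [/\ D != 0, vanishes D &
    forall E, vanishes E -> (size E < size D)%N -> E = 0].
Proof.
have [n] := ubnP (size P); elim: n => // n IHn in P *.
rewrite ltnS => sP P0 vP.
have [|nex] := pselect (exists E, [/\ vanishes E, (size E < size P)%N & E != 0]).
  by case=> E [vE sE E0]; apply: (IHn E) => //; apply: leq_trans sP.
exists P; split=> // E vE sE; apply/eqP; apply: contrapT => /negP E0.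
by apply: nex; exists E.
Qed.

(** With Z infinite in the direction of the inner variable, no nonzero polynomial
    in that variable alone vanishes on Z.  The minimal vanishing D divides P and G
    after clearing denominators; Gauss's lemma removes the denominators, and makes
    D associate to P. *)
Lemma dvd_of_vanishes P G : irreducible_XY P ->
  (forall r : {poly F}, (forall x y, Z x y -> r.[x] = 0) -> r = 0) ->
  vanishes P -> vanishes G -> exists H, G = H * P.
Proof.
move=> [P0 irrP] Zdense vP vG.
have notconst (r : {poly F}) : vanishes r%:P -> r = 0.
  by move=> vr; apply: Zdense => x y /vr; rewrite hornerC.
have [D [D0 vD minD]] := ex_minimal_vanishing P0 vP.
have pseudo A : vanishes A -> exists c B, c != 0 /\ c *: A = B * D.
  move=> vA; exists (lead_coef D ^+ scalp A D), (A %/ D); split.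
    by rewrite expf_neq0 // lead_coef_eq0.
  rewrite Pdiv.Idomain.divp_eq [A %% D]minD ?addr0 ?ltn_modp //.
  exact: vanishes_modp.
have [c [B [c0 /(gauss_factor c0)[b [a [B' [D' [_ DE PE]]]]]]]] := pseudo P vP.
have vD' : vanishes (a *: D') by rewrite -DE.
(* A constant D' would make D a polynomial in the inner variable alone. *)
case: (irrP _ _ PE) => [[k B'E]|[k D'E]]; last first.
  case/eqP: D0; rewrite DE D'E -mul_polyC -polyCM; congr polyC.
  by apply: notconst; rewrite polyCM mul_polyC -D'E.
have k0 : k != 0.
  by apply: contraNneq P0 => k0; rewrite PE B'E k0 !polyC0 mul0r.
have D'P : D' = (k^-1)%:P *: P.
  by rewrite PE B'E mul_polyC scalerA -polyCM mulVf // scale1r.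
have [c1 [B1 [c10]]] := pseudo G vG.
rewrite DE D'P scalerA -scalerAr scalerAl.
case/(gauss_factor c10)=> [b2 [a2 [H [P2 [_ PE2 GE]]]]].
have PE3 : P = a2%:P * P2 by rewrite mul_polyC.
case: (irrP _ _ PE3) => [[k2 /polyC_inj a2E]|[k2 P2E]].
  have k20 : k2 != 0.
    by apply: contraNneq P0 => k20; rewrite PE3 a2E k20 !polyC0 mul0r.
  exists (k2^-1%:P *: H); rewrite GE PE2 -scalerAl -scalerAr scalerA a2E.
  by rewrite -polyCM mulVf // scale1r.
case/eqP: P0; rewrite PE3 P2E -polyCM; congr polyC.
by apply: notconst; rewrite polyCM -P2E -PE3.
Qed.

(** The remaining case, where Z is contained in a vertical line: both polynomials
    are then divisible by its equation. *)
Lemma dvd_of_vanishes_vertical P G (a : F) : irreducible_XY P ->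
  (forall x y, Z x y -> x = a) ->
  (forall r : {poly F}, (forall x y, Z x y -> r.[y] = 0) -> r = 0) ->
  vanishes P -> vanishes G -> exists H, G = H * P.
Proof.
move=> [P0 irrP] Za Zdense vP vG.
have fact A : vanishes A -> exists A', A = ('X - a%:P) *: A'.
  move=> vA; apply: coefs_dvdp_scale => i; rewrite dvdp_XsubCl rootE.
  have : map_poly (horner_eval a) A = 0.
    apply: Zdense => x y Zxy; have := vA x y Zxy; rewrite (Za _ _ Zxy).
    by rewrite -horner_evalE -horner_map /= horner_evalE hornerC.
  move=> /(congr1 (fun r : {poly F} => r`_i)).
  by rewrite coef_map coef0 /= horner_evalE => ->.
have [[P' PE] [G' GE]] := (fact _ vP, fact _ vG).
have PE' : P = ('X - a%:P)%:P * P' by rewrite mul_polyC.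
case: (irrP _ _ PE') => [[k /polyC_inj]|[k P'E]].
  move/(congr1 (fun r : {poly F} => size r)); rewrite size_XsubC size_polyC.
  by case: (k != 0).
have k0 : k != 0.
  by apply: contraNneq P0 => k0; rewrite PE P'E k0 !polyC0 scaler0.
exists (k^-1%:P *: G'); rewrite GE PE P'E -scalerAl -scalerAr -mulrC mul_polyC.
by rewrite !scalerA mulrAC -polyCM mulVf // mul1r.
Qed.

End VanishingIdeal.

(** * Polynomials vanishing on a parametrized plane curve *)

Section MmapExtra.

Lemma eq_mmap n (A B : nzRingType) (f f' : A -> B) (h h' : 'I_n -> B)
    (p : {mpoly A[n]}) : f =1 f' -> h =1 h' -> mmap f h p = mmap f' h' p.
Proof.
move=> ff' hh'; apply: eq_bigr => m _; rewrite ff'; congr (_ * _).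
exact: mmap1_eq.
Qed.

Lemma rmorph_mmap n (A B D : nzRingType) (g : {rmorphism B -> D}) (f : A -> B)
    (h : 'I_n -> B) (p : {mpoly A[n]}) :
  g (mmap f h p) = mmap (g \o f) (g \o h) p.
Proof.
rewrite /mmap rmorph_sum; apply: eq_bigr => m _; rewrite rmorphM; congr (_ * _).
by rewrite /mmap1 rmorph_prod; apply: eq_bigr => i _; rewrite rmorphXn.
Qed.

Lemma exists_nonroot_nat (K : numDomainType) (Q : {poly K}) :
  Q != 0 -> exists n : nat, Q.[n%:R] != 0.
Proof.
move=> Q0; apply: contrapT => nex.
have/(max_poly_roots Q0) : all (root Q) [seq i%:R | i <- iota 0 (size Q)].
  apply/allP => _ /mapP[i _ ->]; rewrite rootE; apply/negP => /negP Qi.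
  by apply: nex; exists i.
rewrite size_map size_iota ltnn => /(_ _)H; suff: false by [].
apply: H; rewrite map_inj_uniq ?iota_uniq // => i j /eqP.
by rewrite eqr_nat => /eqP.
Qed.

Lemma exists_nonroot (K : numDomainType) (Q : {poly K}) :
  Q != 0 -> exists u, Q.[u] != 0.
Proof. by case/exists_nonroot_nat => n; exists n%:R. Qed.

(** Polynomial identities below are proved at the parameters where a given
    denominator Q does not vanish. *)
Lemma poly_eq0_of_values (K : numDomainType) (P Q : {poly K}) : Q != 0 ->
  (forall u, Q.[u] != 0 -> P.[u] = 0) -> P = 0.
Proof.
move=> Q0 PQ; apply/eqP; apply: contrapT => /negP P0.
have [u] := exists_nonroot (mulf_neq0 P0 Q0).
by rewrite hornerM mulf_eq0 negb_or => /andP[/eqP Pu /PQ].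
Qed.
End MmapExtra.

Section Transfer.
Context {F : fieldType}.
Implicit Types (p : {mpoly F[2]}) (P : {poly {poly F}}).

Definition toXY p : {poly {poly F}} :=
  mmap (polyC \o polyC) (fun i : 'I_2 => if i == 0 then 'Y else 'X) p.

(** The inverse of toXY; it exists to transport irreducibility and divisibility
    to iterated polynomials, where Euclidean division is available. *)
Definition ofXY P : {mpoly F[2]} := (map_poly (horner_alg 'X_0) P).['X_1].

HB.instance Definition _ := GRing.RMorphism.copy toXY toXY.
HB.instance Definition _ := GRing.RMorphism.copy ofXY
  (horner_eval 'X_1 \o map_poly (horner_alg 'X_0)).

Lemma toXYK : cancel toXY ofXY.
Proof.
move=> p; rewrite /toXY rmorph_mmap [RHS]mpolyE; apply: eq_bigr => m _.
rewrite -mul_mpolyC; congr (_ * _).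
  by rewrite /= /ofXY map_polyC hornerC /= horner_algC -mul_mpolyC mulr1.
rewrite mpolyXE_id; apply: eq_bigr => i _; congr (_ ^+ _).
case: i => -[|[|//]] lti /=; rewrite /ofXY.
  by rewrite map_polyC hornerC /= horner_algX; congr 'X_[U_(_)]; apply: val_inj.
by rewrite map_polyX hornerX; congr 'X_[U_(_)]; apply: val_inj.
Qed.

Lemma toXY_X0 : toXY 'X_0 = 'Y.
Proof. by rewrite /toXY mmapX mmap1U. Qed.

Lemma toXY_X1 : toXY 'X_1 = 'X.
Proof. by rewrite /toXY mmapX mmap1U. Qed.

Lemma toXY_C c : toXY c%:MP = c%:P%:P.
Proof. by rewrite /toXY mmapC. Qed.

Lemma ofXYK : cancel ofXY toXY.
Proof.
have inner (r : {poly F}) : toXY (horner_alg 'X_0 r) = r%:P.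
  elim/poly_ind: r => [|r c IH]; first by rewrite !rmorph0.
  rewrite !rmorphD !rmorphM /= IH horner_algX toXY_X0; congr (_ + _).
  by rewrite horner_algC -mul_mpolyC mulr1 toXY_C.
elim/poly_ind=> [|P r IH]; first by rewrite !rmorph0.
rewrite !rmorphD !rmorphM /= IH; congr (_ * _ + _).
  by rewrite /ofXY map_polyX hornerX toXY_X1.
by rewrite /ofXY map_polyC hornerC /= inner.
Qed.

Lemma horner_toXY p x y :
  (toXY p).[y%:P].[x] = p.@[fun i => if i == 0 then x else y].
Proof.
rewrite -[LHS]/((horner_eval x \o horner_eval y%:P) (toXY p)) rmorph_mmap.
apply: eq_mmap => [c|i] /=; first by rewrite !horner_evalE !hornerC.
by case: ifP => _; rewrite !horner_evalE ?hornerX !hornerC ?hornerX.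
Qed.

End Transfer.

Section Curve.
Context {R : realType}.
Implicit Types (p g : {mpoly R[2]}) (q : {poly R}).

Lemma toXY_irreducible p : mirreducible p -> irreducible_XY (toXY p).
Proof.
move=> [sp irrp]; split.
  by apply: contraTneq sp => p0; rewrite -[p]toXYK p0 rmorph0 msize0.
have const (D : {poly {poly R}}) :
    (msize (ofXY D) <= 1)%N -> exists k, D = k%:P%:P.
  by move=> /msize1_polyC sD; exists (ofXY D)@_0; rewrite -toXY_C -sD ofXYK.
move=> D E DE; have pE : p = ofXY D * ofXY E by rewrite -[LHS]toXYK DE rmorphM.
by case: (irrp _ _ pE) => /const; [left|right].
Qed.

(** A nonconstant rational function is not a root of a nonzero polynomial: each
    value a that q / q0 takes is a root of r, which can be divided out at the
    cost of excluding the finitely many zeros of q - a q0. *)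
Lemma ratio_algebraic_const q0 q (r Q : {poly R}) :
  q0 != 0 -> Q != 0 -> r != 0 ->
  (forall u, Q.[u] != 0 -> q0.[u] != 0 -> r.[q.[u] / q0.[u]] = 0) ->
  exists a, q = a *: q0.
Proof.
move=> q00; have [n] := ubnP (size r); elim: n => // n IHn in r Q *.
rewrite ltnS => sr Q0 r0 rQ.
have [u] := exists_nonroot (mulf_neq0 Q0 q00).
rewrite hornerM mulf_eq0 negb_or => /andP[Qu q0u].
pose a := q.[u] / q0.[u].
have /factor_theorem[r' rE] : root r a by rewrite rootE; apply/eqP/rQ.
have [/eqP|qa] := eqVneq (q - a *: q0) 0.
  by rewrite subr_eq0 => /eqP ->; exists a.
have r'0 : r' != 0 by apply: contraNneq r0 => r'0; rewrite rE r'0 mul0r.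
apply: (IHn r' (Q * (q - a *: q0))) => //; last 2 first.
- exact: mulf_neq0.
- move=> v; rewrite hornerM mulf_eq0 negb_or => /andP[Qv qav] q0v.
  have := rQ v Qv q0v; rewrite rE hornerM hornerXsubC => /eqP.
  rewrite mulf_eq0 => /orP[/eqP//|]; rewrite subr_eq0 => /eqP qa'.
  by move: qav; rewrite !hornerE -qa' divfK // subrr eqxx.
apply: leq_trans sr; rewrite rE size_mul ?polyXsubC_eq0 // size_XsubC addn2.
by [].
Qed.

Variables q0 q1 q2 : {poly R}.

Definition vanishes_on_param g :=
  forall u, q0.[u] != 0 -> peval g (param_point q0 q1 q2 u) = 0.

(** The ideal of a rational plane curve is generated by its irreducible
    equation.  A coordinate that is not constant on the curve takes infinitely
    many values, by ratio_algebraic_const. *)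
Lemma dvd_of_vanishes_on_param p g : mirreducible p -> q0 != 0 ->
  ~ (exists a b, q1 = a *: q0 /\ q2 = b *: q0) ->
  vanishes_on_param p -> vanishes_on_param g -> exists h, g = h * p.
Proof.
move=> /toXY_irreducible irrp q00 nconst vp vg.
pose Z x y := exists2 u, q0.[u] != 0 & x = q1.[u] / q0.[u] /\ y = q2.[u] / q0.[u].
have vZ f : vanishes_on_param f -> vanishes Z (toXY f).
  move=> vf _ _ [u q0u [-> ->]]; rewrite horner_toXY -(vf u q0u) /peval.
  by apply: meval_eq => i; rewrite mxE.
suff [H HE] : exists H, toXY g = H * toXY p.
  by exists (ofXY H); rewrite -[g]toXYK HE rmorphM /= toXYK.
have [[a q1a]|nq1] := pselect (exists a, q1 = a *: q0).
  apply: (dvd_of_vanishes_vertical (Z := Z) (a := a) irrp _ _ (vZ _ vp) (vZ _ vg)).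
    by move=> _ _ [u q0u [-> _]]; rewrite q1a hornerZ mulfK.
  move=> r rZ; apply/eqP; apply: contrapT => /negP r0; apply: nconst.
  have [||||b q2b] := @ratio_algebraic_const q0 q2 r 1 => //; first exact: oner_neq0.
    by move=> u _ q0u; apply: (rZ (q1.[u] / q0.[u])); exists u.
  by exists a, b.
apply: (dvd_of_vanishes (Z := Z) irrp _ (vZ _ vp) (vZ _ vg)) => r rZ.
apply/eqP; apply: contrapT => /negP r0; apply: nq1.
apply: (@ratio_algebraic_const q0 q1 r 1) => //; first exact: oner_neq0.
by move=> u _ q0u; apply: (rZ _ (q2.[u] / q0.[u])); exists u.
Qed.
End Curve.

(** * Bezoutians and Vandermonde congruences *)

Section Bezout.
Context {R : realType}.
Implicit Types (f g : {poly R}).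

Lemma bezout_poly_uniq f g (b : {poly {poly R}}) :
  b * ('X - 'Y) = f^:P * g%:P - f%:P * g^:P -> b = bezout_poly f g.
Proof.
rewrite -bezout_polyE; apply: mulIf.
by rewrite -size_poly_gt0 size_XsubC.
Qed.

Lemma bezout_poly_sym f g : swapXY (bezout_poly f g) = bezout_poly f g.
Proof.
apply: bezout_poly_uniq; have := congr1 (@swapXY R) (bezout_polyE f g).
rewrite rmorphM !rmorphB !rmorphM /= swapXY_X swapXY_Y !swapXY_map_polyC.
rewrite !swapXY_polyC -opprB mulrN => /(congr1 -%R); rewrite opprK => ->.
by rewrite opprB mulrC [X in _ - X]mulrC [RHS]addrC [RHS]addrC.
Qed.

Lemma size_bezout_poly m f g : (size f <= m.+1)%N -> (size g <= m.+1)%N ->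
  (size (bezout_poly f g) <= m)%N.
Proof.
move=> sf sg; have [->|b0] := eqVneq (bezout_poly f g) 0; first by rewrite size_poly0.
rewrite -ltnS -[X in (X <= _)%N]addn1.
have <- : size (bezout_poly f g * ('X - 'Y)) = (size (bezout_poly f g) + 1)%N.
  by rewrite size_Mmonic ?monicXsubC // size_XsubC addn2 addn1.
rewrite bezout_polyE (leq_trans (size_polyD _ _)) // size_polyN geq_max.
rewrite mulrC !mul_polyC.
by rewrite !(leq_trans (size_scale_leq _ _)) // size_map_polyC.
Qed.

Lemma size_coef_bezout_poly m f g k : (size f <= m.+1)%N -> (size g <= m.+1)%N ->
  (size ((bezout_poly f g)`_k)%R <= m)%N.
Proof.
move=> sf sg; apply: leq_trans (max_size_coefXY _ _) _.
by rewrite sizeYE bezout_poly_sym size_bezout_poly.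
Qed.

Lemma trmx_bezoutian m f g : (bezoutian m f g)^T = bezoutian m f g.
Proof.
by apply/matrixP=> i j; rewrite !mxE -coef_swapXY bezout_poly_sym.
Qed.

End Bezout.

Section BezoutEval.
Context {R : realType} {K : comNzRingType} (iota : {rmorphism R -> K}).
Implicit Types (f g : {poly R}) (a b : K).
Local Notation "f ^i" := (map_poly iota f) (at level 2, format "f ^i").

Definition bezout_at f g b : {poly K} :=
  map_poly (horner_eval b \o map_poly iota) (bezout_poly f g).

Lemma bezout_atE f g b : bezout_at f g b * ('X - b%:P) =
  f^i * (g^i.[b])%:P - (f^i.[b])%:P * g^i.
Proof.
have := congr1 (map_poly (horner_eval b \o map_poly iota)) (bezout_polyE f g).
rewrite rmorphM !rmorphB !rmorphM /= map_polyX !map_polyC /= map_polyX.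
rewrite !horner_evalE hornerX => ->.
suff hP q : map_poly (horner_eval b \o map_poly iota) q^:P = q^i by rewrite !hP.
rewrite -map_poly_comp; apply: eq_map_poly => c /=.
by rewrite map_polyC horner_evalE hornerC.
Qed.

Lemma bezout_at_offdiag f g a b : (bezout_at f g b).[a] * (a - b) =
  f^i.[a] * g^i.[b] - f^i.[b] * g^i.[a].
Proof.
have := congr1 (fun P : {poly K} => P.[a]) (bezout_atE f g b).
by rewrite !hornerE.
Qed.

Definition wronskian f g := f^`() * g - f * g^`().

(** Differentiating the equation of the Bezout polynomial at the diagonal leaves
    the Wronskian. *)
Lemma bezout_at_diag f g a : (bezout_at f g a).[a] = (wronskian f g)^i.[a].
Proof.
have /= := congr1 (fun P : {poly K} => P^`().[a]) (bezout_atE f g a).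
rewrite derivM derivXsubC derivB !derivM !derivC mul0r mulr0 add0r addr0.
rewrite !hornerE subrr mulr0 add0r => ->.
by rewrite /wronskian rmorphB !rmorphM /= !deriv_map !hornerE.
Qed.

Lemma bezout_at_sum m f g a b : (size f <= m.+1)%N -> (size g <= m.+1)%N ->
  (bezout_at f g b).[a] =
  \sum_(k < m) \sum_(l < m) a ^+ k * iota (bezoutian m f g k l) * b ^+ l.
Proof.
move=> sf sg.
have s1 : (size (bezout_at f g b) <= m)%N.
  exact: leq_trans (size_poly _ _) (size_bezout_poly sf sg).
rewrite (horner_coef_wide _ s1); apply: eq_bigr => k _.
rewrite coef_map /= horner_evalE.
have s2 : (size (map_poly iota (bezout_poly f g)`_k)%R <= m)%N.
  exact: leq_trans (size_poly _ _) (size_coef_bezout_poly _ sf sg).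
rewrite (horner_coef_wide _ s2) mulr_suml; apply: eq_bigr => l _.
by rewrite coef_map mxE /=; ring.
Qed.

(** The column (1, a, ..., a^(m-1)) stands for evaluation at a, and the
    coefficients of the Bezout polynomial are paired with two such columns. *)
Lemma Vandermonde_bezoutian m n f g (a : 'rV[K]_n) i j :
  (size f <= m.+1)%N -> (size g <= m.+1)%N ->
  ((Vandermonde m a)^T *m map_mx iota (bezoutian m f g) *m Vandermonde m a) i j =
  (bezout_at f g (a 0 j)).[a 0 i].
Proof.
move=> sf sg; rewrite (bezout_at_sum _ _ sf sg) mxE exchange_big /=.
apply: eq_bigr => l _; rewrite mxE mulr_suml; apply: eq_bigr => k _.
by rewrite !mxE.
Qed.

End BezoutEval.
Arguments bezout_at {R K} iota f g b.

Section Pencil.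
Context {R : realType}.
Variables (m : nat) (q0 q1 q2 : {poly R}).
Hypotheses (s0 : (size q0 <= m.+1)%N) (s1 : (size q1 <= m.+1)%N)
  (s2 : (size q2 <= m.+1)%N).

(** By bilinearity this is the Bezoutian of q1 - x q0 and q2 - y q0.  It is
    spelled out so that x and y can be indeterminates or complex numbers. *)
Definition pencil (K : comNzRingType) (iota : {rmorphism R -> K}) (x y : K)
    : 'M[K]_m :=
  map_mx iota (bezoutian m q1 q2) - y *: map_mx iota (bezoutian m q1 q0)
  - x *: map_mx iota (bezoutian m q0 q2).

Lemma pencilE (K : comNzRingType) (iota : {rmorphism R -> K}) x y i j :
  pencil iota x y i j = iota (bezoutian m q1 q2 i j) -
    y * iota (bezoutian m q1 q0 i j) - x * iota (bezoutian m q0 q2 i j).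
Proof. by rewrite !mxE. Qed.

Lemma map_pencil (K L : comNzRingType) (iota : {rmorphism R -> K})
    (iota' : {rmorphism R -> L}) (h : {rmorphism K -> L}) x y :
  h \o iota =1 iota' -> map_mx h (pencil iota x y) = pencil iota' (h x) (h y).
Proof.
move=> hi; apply/matrixP => i j.
by rewrite !mxE !rmorphB !rmorphM /= -!hi.
Qed.

Section OverRing.
Context {K : comNzRingType} (iota : {rmorphism R -> K}).
Local Notation "f ^i" := (map_poly iota f) (at level 2, format "f ^i").

Lemma Vandermonde_pencil n (a : 'rV[K]_n) x y i j :
  ((Vandermonde m a)^T *m pencil iota x y *m Vandermonde m a) i j =
  (bezout_at iota q1 q2 (a 0 j)).[a 0 i] - y * (bezout_at iota q1 q0 (a 0 j)).[a 0 i]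
  - x * (bezout_at iota q0 q2 (a 0 j)).[a 0 i].
Proof.
rewrite /pencil !mulmxBr !mulmxBl -!scalemxAr -!scalemxAl.
rewrite -(Vandermonde_bezoutian iota a i j s1 s2).
rewrite -(Vandermonde_bezoutian iota a i j s1 s0).
rewrite -(Vandermonde_bezoutian iota a i j s0 s2).
have sub (A B C : 'M[K]_n) :
    (A - y *: B - x *: C) i j = A i j - y * B i j - x * C i j.
  by rewrite !mxE.
exact: sub.
Qed.

Lemma Vandermonde_pencil_offdiag n (a : 'rV[K]_n) x y i j :
  ((Vandermonde m a)^T *m pencil iota x y *m Vandermonde m a) i j *
  (a 0 i - a 0 j) =
  (q1^i.[a 0 i] - x * q0^i.[a 0 i]) * (q2^i.[a 0 j] - y * q0^i.[a 0 j]) -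
  (q1^i.[a 0 j] - x * q0^i.[a 0 j]) * (q2^i.[a 0 i] - y * q0^i.[a 0 i]).
Proof.
by rewrite Vandermonde_pencil !mulrBl -!mulrA !bezout_at_offdiag; ring.
Qed.

Lemma Vandermonde_pencil_diag n (a : 'rV[K]_n) x y i :
  ((Vandermonde m a)^T *m pencil iota x y *m Vandermonde m a) i i =
  (wronskian q1 q2)^i.[a 0 i] - y * (wronskian q1 q0)^i.[a 0 i]
  - x * (wronskian q0 q2)^i.[a 0 i].
Proof. by rewrite Vandermonde_pencil !bezout_at_diag. Qed.

End OverRing.
End Pencil.
Arguments pencil {R} m q0 q1 q2 {K} iota x y.

(** * The points of the curve on a line through the origin *)

Lemma colinear (K : fieldType) (x y z1 z2 : K) :
  (z1 != 0) || (z2 != 0) -> x * z2 = y * z1 ->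
  exists s, x = s * z1 /\ y = s * z2.
Proof.
case/orP => z0 e.
  by exists (x / z1); split; [rewrite divfK|rewrite mulrAC e mulfK].
by exists (y / z2); split; [rewrite mulrAC -e mulfK|rewrite divfK].
Qed.

Lemma simple_roots_row (K : closedFieldType) (f : {poly K}) k :
  size f = k.+1 -> (forall w, root f w -> f^`().[w] != 0) ->
  exists2 a : 'rV[K]_k, injective (a 0) & forall w, root f w <-> exists i, w = a 0 i.
Proof.
move=> sf simple; have f0 : f != 0 by rewrite -size_poly_gt0 sf.
have [rs fE] := closed_field_poly_normal f.
have lf0 : lead_coef f != 0 by rewrite lead_coef_eq0.
have srs : size rs = k.
  by move: sf; rewrite fE size_scale // size_prod_XsubC => -[].
have urs : uniq rs.
  rewrite -separable_prod_XsubC.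
  have <- : separable_poly f = separable_poly (\prod_(z <- rs) ('X - z%:P)).
    by apply: eqp_separable; rewrite {1}fE eqp_scale.
  by rewrite unlock; apply: Pdiv.ClosedField.root_coprimep.
exists (\row_i nth 0 rs i).
  move=> i j; rewrite !mxE => /eqP; rewrite nth_uniq ?srs //.
  by move=> /eqP /val_inj.
move=> w; rewrite fE rootZ // root_prod_XsubC; split=> [wrs|[i ->]].
  have lti : (index w rs < k)%N by rewrite -srs index_mem.
  by exists (Ordinal lti); rewrite mxE nth_index.
by rewrite mxE mem_nth // srs.
Qed.

Section GenericDirection.
Context {R : realType}.
Local Notation C := R[i].
Local Notation iota := (real_complex R).
Local Notation "f ^C" := (map_poly iota f) (format "f ^C").
Variables (k : nat) (q1 q2 : {poly R}).
Hypotheses (k_gt0 : (0 < k)%N) (s1 : (size q1 <= k.+1)%N)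
  (s2 : (size q2 <= k.+1)%N).
Hypothesis top_neq0 : (q1`_k != 0) || (q2`_k != 0).
Hypothesis no_common_root : forall w, (q1^C.[w] != 0) || (q2^C.[w] != 0).

(** Its roots are the parameters of the points on the line spanned by
    (z1, z2). *)
Definition line_poly (z1 z2 : C) : {poly C} := z2 *: q1^C - z1 *: q2^C.

Lemma line_polyE z1 z2 w : (line_poly z1 z2).[w] = z2 * q1^C.[w] - z1 * q2^C.[w].
Proof. by rewrite !hornerE. Qed.

(** Over an algebraically closed field, proportional polynomials without common
    roots are constant. *)
Lemma size_le1_of_no_common_root (f g : {poly C}) (z z' : C) : z != 0 ->
  z *: f = z' *: g -> (forall w, (f.[w] != 0) || (g.[w] != 0)) ->
  (size f <= 1)%N /\ (size g <= 1)%N.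
Proof.
move=> z0 e nocommon.
have fE : f = (z' / z) *: g.
  by apply: (scalerI z0); rewrite e scalerA mulrC divfK.
have/eqP sg : size g == 1%N.
  apply/negPn/negP => /closed_rootP[w gw].
  have := nocommon w; rewrite fE hornerZ (eqP gw) mulr0 eqxx //.
by rewrite sg fE; split=> //; rewrite (leq_trans (size_scale_leq _ _)) ?sg.
Qed.

Lemma not_both_const : ~ ((size q1 <= 1)%N /\ (size q2 <= 1)%N).
Proof.
case=> c1 c2; have := top_neq0.
by rewrite !nth_default ?eqxx // (leq_trans _ k_gt0).
Qed.

Lemma line_poly_neq0 z1 z2 : (z1 != 0) || (z2 != 0) -> line_poly z1 z2 != 0.
Proof.
move=> z0; apply/eqP => /eqP; rewrite subr_eq0 => /eqP e.
apply: not_both_const; rewrite -(size_map_poly iota q1) -(size_map_poly iota q2).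
case/orP: z0 => z0; last exact: size_le1_of_no_common_root z0 e no_common_root.
suff [? ?] : (size q2^C <= 1)%N /\ (size q1^C <= 1)%N by [].
by apply: (size_le1_of_no_common_root z0 (esym e)) => w; rewrite orbC.
Qed.

(** If the Wronskian vanished, the coprime q1 and q2 would divide their own
    derivatives, hence be constant. *)
Lemma wronskian_neq0 : wronskian q1 q2 != 0.
Proof.
apply/eqP => /eqP; rewrite subr_eq0 => /eqP W0.
have cop : coprimep q1 q2.
  rewrite -(coprimep_map iota); apply: Pdiv.ClosedField.root_coprimep => w q1w.
  by have := no_common_root w; rewrite (eqP q1w) eqxx.
have der0 (f g : {poly R}) : coprimep f g -> f %| f^`() * g -> (size f <= 1)%N.
  move=> fg; rewrite (Gauss_dvdpl _ fg) => fd; rewrite leqNgt; apply/negP => sf.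
  have f'0 : f^`() != 0 by rewrite -size_poly_gt0 size_deriv -subn1 subn_gt0.
  have := dvdp_leq f'0 fd; rewrite size_deriv leqNgt prednK ?leqnn //.
  exact: ltnW.
apply: not_both_const; split; first by apply: der0 cop _; rewrite W0 dvdp_mulr.
apply: (der0 _ q1); first by rewrite coprimep_sym.
by rewrite mulrC -W0 dvdp_mull.
Qed.

(** At a root of the line polynomial, the Wronskian is a multiple of the
    derivative of that polynomial, so the root is simple. *)
Lemma generic_line_roots z1 z2 (z0 : (z1 != 0) || (z2 != 0)) :
  z2 * iota q1`_k - z1 * iota q2`_k != 0 ->
  (forall w, root (line_poly z1 z2) w -> (wronskian q1 q2)^C.[w] != 0) ->
  exists2 a : 'rV[C]_k, injective (a 0) &
    forall w, root (line_poly z1 z2) w <-> exists i, w = a 0 i.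
Proof.
move=> lead W; apply: simple_roots_row.
  apply/eqP; rewrite eqn_leq; apply/andP; split.
    apply: leq_trans (size_polyD _ _) _; rewrite size_polyN geq_max.
    by rewrite !(leq_trans (size_scale_leq _ _)) // size_map_poly.
  by rewrite ltnNge; apply: contra lead => /leq_sizeP/(_ k (leqnn k)) <-;
    rewrite coefB !coefZ !coef_map.
move=> w rw; apply: contraNneq (W w rw) => d0.
have e : q1^C.[w] * z2 = q2^C.[w] * z1.
  by apply/eqP; rewrite -subr_eq0 mulrC [X in _ - X]mulrC -line_polyE.
have [s [q1w q2w]] := colinear z0 e.
rewrite /wronskian rmorphB !rmorphM /= -!deriv_map hornerD hornerN !hornerM q1w q2w.
rewrite derivB !derivZ hornerD hornerN !hornerZ in d0.
have alg (A B : C) : A * (s * z2) - s * z1 * B = s * (z2 * A - z1 * B) by ring.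
by rewrite alg d0 mulr0.
Qed.

(** Every parameter lies on one line through the origin only, so that avoiding
    finitely many parameters, infinity included, means avoiding finitely many
    lines. *)
Lemma exists_generic_direction (s : seq C) : exists u : R,
  let z1 := iota q1.[u] in let z2 := iota q2.[u] in
  [/\ (z1 != 0) || (z2 != 0), z2 * iota q1`_k - z1 * iota q2`_k != 0 &
   forall w, root (line_poly z1 z2) w ->
     (wronskian q1 q2)^C.[w] != 0 /\ w \notin s].
Proof.
have [rW WE] := closed_field_poly_normal (wronskian q1 q2)^C.
pose Q := line_poly (iota q1`_k) (iota q2`_k) *
  \prod_(w <- rW ++ s) line_poly q1^C.[w] q2^C.[w].
have Q0 : Q != 0.
  rewrite mulf_neq0 //; first by apply: line_poly_neq0; rewrite !fmorph_eq0.
  by rewrite prodf_seq_neq0; apply/allP => w _; rewrite /= line_poly_neq0.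
have [n] := exists_nonroot_nat Q0; rewrite hornerM mulf_eq0 negb_or.
case/andP=> lead; rewrite horner_prod prodf_seq_neq0 => /allP others.
have evn (f : {poly R}) : f^C.[n%:R] = iota f.[n%:R].
  by rewrite -horner_map /= rmorph_nat.
exists n%:R => z1 z2; split.
- by have := no_common_root n%:R; rewrite !evn.
- by move: lead; rewrite line_polyE !evn -oppr_eq0 opprB ![iota _`_k * _]mulrC.
move=> w; rewrite rootE line_polyE => /eqP rw.
have : w \notin rW ++ s.
  apply/negP => /others /=; rewrite line_polyE !evn -/z1 -/z2 -oppr_eq0 opprB.
  by rewrite mulrC [X in _ - X]mulrC rw eqxx.
rewrite mem_cat negb_or => /andP[wW ->]; split=> //.
rewrite -rootE; move: wW; apply: contra.
have W0 : (wronskian q1 q2)^C != 0 by rewrite map_poly_eq0 wronskian_neq0.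
by rewrite WE rootZ ?lead_coef_eq0 // root_prod_XsubC.
Qed.

Variable q0 : {poly R}.
Hypothesis s0 : (size q0 <= k.+1)%N.

(** The derivative of the line polynomial. *)
Definition slope (z1 z2 w : C) := z2 * q1^`()^C.[w] - z1 * q2^`()^C.[w].

Lemma wronskian_slope (z1 z2 s w : C) :
  q1^C.[w] = s * z1 -> q2^C.[w] = s * z2 ->
  (wronskian q1 q2)^C.[w] = s * slope z1 z2 w.
Proof.
move=> q1w q2w; rewrite /wronskian rmorphB !rmorphM /= hornerD hornerN !hornerM.
by rewrite q1w q2w /slope; ring.
Qed.

(** On the line spanned by (z1, z2), the Vandermonde matrix of the roots
    diagonalizes the whole pencil, since q1 - x q0 and q2 - y q0 remain
    proportional to (z1, z2) at these parameters. *)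
Lemma det_pencil_roots (z1 z2 t : C) (a : 'rV[C]_k) (s : 'I_k -> C) :
  injective (a 0) ->
  (forall i, q1^C.[a 0 i] = s i * z1 /\ q2^C.[a 0 i] = s i * z2) ->
  \det (Vandermonde k a) ^+ 2 * \det (pencil k q0 q1 q2 iota (t * z1) (t * z2)) =
  \prod_i ((s i - t * q0^C.[a 0 i]) * slope z1 z2 (a 0 i)).
Proof.
move=> inja sz; pose V := Vandermonde k a.
pose M := V^T *m pencil k q0 q1 q2 iota (t * z1) (t * z2) *m V.
have -> : \det V ^+ 2 * \det (pencil k q0 q1 q2 iota (t * z1) (t * z2)) = \det M.
  by rewrite /M !det_mulmx det_tr; ring.
suff -> : M = diag_mx (\row_i ((s i - t * q0^C.[a 0 i]) * slope z1 z2 (a 0 i))).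
  by rewrite det_diag; apply: eq_bigr => i _; rewrite mxE.
apply/matrixP => i j; rewrite [RHS]mxE [in RHS]mxE.
have [->|nij] := eqVneq i j; last first.
  have aij : a 0 i - a 0 j != 0.
    by rewrite subr_eq0; apply: contra nij => /eqP /inja ->.
  apply: (mulIf aij); rewrite mul0r (Vandermonde_pencil_offdiag s0 s1 s2).
  by have [-> ->] := sz i; have [-> ->] := sz j; ring.
rewrite (Vandermonde_pencil_diag s0 s1 s2) /wronskian !rmorphB !rmorphM /=.
rewrite !(hornerD, hornerN, hornerM) /slope; have [-> ->] := sz j; rewrite mulr1n; ring.
Qed.

Lemma det_Vandermonde_neq0 (K : fieldType) n (a : 'rV[K]_n) :
  injective (a 0) -> \det (Vandermonde n a) != 0.
Proof.
move=> inja; rewrite det_Vandermonde; apply/prodf_neq0 => i _.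
apply/prodf_neq0 => j; rewrite subr_eq0; apply: contraTneq => /inja ->.
by rewrite ltnn.
Qed.

End GenericDirection.

(** * Homogenization, and the parameter at infinity *)

Section Homogenization.
Context {R : realType}.
Implicit Types (g : {mpoly R[2]}).
Variables q0 q1 q2 : {poly R}.

(** Nonreal parameters lead to points of the plane with complex coordinates. *)
Definition plane_eval (K : comNzRingType) (iota : {rmorphism R -> K}) (x y : K) g : K :=
  mmap iota (fun i : 'I_2 => if i == 0 then x else y) g.

HB.instance Definition _ (K : comNzRingType) (iota : {rmorphism R -> K}) x y :=
  GRing.RMorphism.copy (plane_eval iota x y) (plane_eval iota x y).

Lemma plane_evalE (K : comNzRingType) (iota : {rmorphism R -> K}) x y g :
  plane_eval iota x y g =
  \sum_(m <- msupp g) iota g@_m * (x ^+ m 0 * y ^+ m 1).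
Proof.
apply: eq_bigr => m _; rewrite /mmap1 !big_ord_recl big_ord0 mulr1 /=.
by congr (_ * (_ ^+ m _ * _ ^+ m _)); apply: val_inj.
Qed.

Lemma plane_eval_real (K : comNzRingType) (iota : {rmorphism R -> K}) (z : 'rV[R]_2) g :
  plane_eval iota (iota (z 0 0)) (iota (z 0 1)) g = iota (peval g z).
Proof.
rewrite [RHS]rmorph_mmap; apply: eq_mmap => // i /=.
by case: i => -[|[|//]] lti; congr (iota (z _ _)); apply: val_inj.
Qed.

Lemma mdeg2 (m : 'X_{1..2}) : mdeg m = (m 0%R + m 1%R)%N.
Proof.
rewrite mdegE !big_ord_recl big_ord0 addn0.
by congr (m _ + m _)%N; apply: val_inj.
Qed.

(** A power of q0 clears the denominators of g (q1 / q0, q2 / q0), so that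
    vanishing on the curve becomes a polynomial identity, valid at nonreal
    parameters as well. *)
Definition homogenize g : {poly R} :=
  \sum_(m <- msupp g)
    g@_m *: (q1 ^+ m 0 * q2 ^+ m 1 * q0 ^+ (msize g - mdeg m)).

Section Eval.
Context {K : fieldType} (iota : {rmorphism R -> K}).
Local Notation "f ^i" := (map_poly iota f) (at level 2, format "f ^i").

Lemma horner_homogenize g u : q0^i.[u] != 0 ->
  (homogenize g)^i.[u] = q0^i.[u] ^+ msize g *
    plane_eval iota (q1^i.[u] / q0^i.[u]) (q2^i.[u] / q0^i.[u]) g.
Proof.
move=> q0u; rewrite /homogenize rmorph_sum horner_sum plane_evalE mulr_sumr.
rewrite !big_seq; apply: eq_bigr => m mg /=.
rewrite linearZ hornerZ !rmorphM !rmorphXn /= !hornerM !horner_exp.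
rewrite !expr_div_n mdeg2.
have le : (m 0%R + m 1%R <= msize g)%N by rewrite -mdeg2 ltnW ?msize_mdeg_lt.
rewrite -{2}(subnK le) !exprD.
have alg (c X Y A B N : K) : A != 0 -> B != 0 ->
  c * (X * Y * N) = N * (A * B) * (c * (X / A * (Y / B))).
  by move=> a0 b0; field; rewrite a0 b0.
by apply: alg; rewrite expf_neq0.
Qed.
End Eval.

Lemma horner_homogenize_real g u : q0.[u] != 0 ->
  (homogenize g).[u] = q0.[u] ^+ msize g * peval g (param_point q0 q1 q2 u).
Proof.
move=> q0u; have := @horner_homogenize _ (@idfun R) g u.
rewrite !map_poly_id // => ->//; congr (_ * _).
by rewrite -[RHS](plane_eval_real idfun) !mxE.
Qed.

Lemma vanishes_on_param_homogenize g : q0 != 0 ->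
  vanishes_on_param q0 q1 q2 g <-> homogenize g = 0.
Proof.
move=> q00.
have E := horner_homogenize_real g.
split=> [vg|hg u q0u].
  by apply: (poly_eq0_of_values q00) => u q0u; rewrite E // vg // mulr0.
have /eqP := E u q0u; rewrite hg horner0 eq_sym mulf_eq0 expf_eq0 (negPf q0u).
by rewrite andbF => /eqP.
Qed.

End Homogenization.

Section Reverse.
Context {R : realType}.
Variable k : nat.
Implicit Types q : {poly R}.

(** The parametrization after the change of parameter 1 / u: infinity becomes
    0. *)
Definition reverse_poly q : {poly R} := \poly_(i < k.+1) q`_(k - i).

Lemma horner_reverse q u : (size q <= k.+1)%N -> u != 0 ->
  (reverse_poly q).[u] = u ^+ k * q.[u^-1].
Proof.
move=> sq u0; rewrite horner_poly (horner_coef_wide _ sq) mulr_sumr.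
rewrite (reindex_inj rev_ord_inj); apply: eq_bigr => i _ /=.
have le : (i <= k)%N by rewrite -ltnS.
rewrite subSS subKn // mulrCA; congr (_ * _).
have -> : u ^+ k = u ^+ (k - i) * u ^+ i by rewrite -exprD subnK.
by rewrite -mulrA -exprMn divff // expr1n mulr1.
Qed.

Lemma vanishes_on_reverse q0 q1 q2 g :
  q0 != 0 -> (size q0 <= k.+1)%N -> (size q1 <= k.+1)%N -> (size q2 <= k.+1)%N ->
  vanishes_on_param q0 q1 q2 g -> reverse_poly q0 != 0 /\
  vanishes_on_param (reverse_poly q0) (reverse_poly q1) (reverse_poly q2) g.
Proof.
move=> q00 s0 s1 s2 vg.
have X0 : 'X != 0 :> {poly R} by rewrite polyX_eq0.
have [v] := exists_nonroot (mulf_neq0 X0 q00).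
rewrite hornerM hornerX mulf_eq0 negb_or => /andP[v0 q0v].
have r0 : reverse_poly q0 != 0.
  apply: contraNneq q0v => r0; have := horner_reverse s0 (invr_neq0 v0).
  by rewrite r0 horner0 invrK => /esym/eqP; rewrite mulf_eq0 expf_eq0 invr_eq0
    (negPf v0) andbF.
split=> //; apply/(vanishes_on_param_homogenize _ _ _ r0).
have XQ0 : 'X * reverse_poly q0 != 0 by rewrite mulf_neq0.
apply: (poly_eq0_of_values XQ0) => u.
rewrite hornerM hornerX mulf_eq0 negb_or => /andP[u0 rq0u].
have uk : u ^+ k != 0 by rewrite expf_neq0.
have q0u : q0.[u^-1] != 0.
  by apply: contra rq0u => /eqP q0u; rewrite horner_reverse // q0u mulr0.
rewrite horner_homogenize_real // (_ : param_point _ _ _ _ = param_point q0 q1 q2 u^-1).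
  by rewrite vg // mulr0.
by apply/rowP => i; rewrite !mxE !horner_reverse // -!mulf_div divff // !mul1r.
Qed.

Lemma horner0_reverse q : (reverse_poly q).[0] = q`_k.
Proof. by rewrite horner_coef0 coef_poly subn0. Qed.

End Reverse.

Section Coprimality.
Context {R : realType}.
Local Notation C := R[i].
Local Notation iota := (real_complex R).
Local Notation "f ^C" := (map_poly iota f) (format "f ^C").
Variables (p : {mpoly R[2]}) (q0 q1 q2 : {poly R}).
Hypotheses (p0 : peval p 0 = 1) (q00 : q0 != 0)
  (vp : vanishes_on_param q0 q1 q2 p).

(** A common root of q1 and q2 is a parameter of the origin. *)
Lemma no_common_root_of_vanishes (w : C) :
  [|| q0^C.[w] != 0, q1^C.[w] != 0 | q2^C.[w] != 0] ->
  (q1^C.[w] != 0) || (q2^C.[w] != 0).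
Proof.
case/orP => // q0w; apply: contraT; rewrite negb_or !negbK => /andP[/eqP q1w /eqP q2w].
have := @horner_homogenize _ q0 q1 q2 _ iota p w q0w.
have /vanishes_on_param_homogenize -> // := vp.
rewrite rmorph0 horner0 q1w q2w !mul0r.
have := plane_eval_real iota 0 p; rewrite !mxE rmorph0 p0 rmorph1 => -> /eqP.
by rewrite mulr1 eq_sym expf_eq0 (negPf q0w) andbF.
Qed.

End Coprimality.

Section TopCoefficients.
Context {R : realType}.
Variables (p : {mpoly R[2]}) (q0 q1 q2 : {poly R}) (k : nat).
Hypotheses (p0 : peval p 0 = 1) (q00 : q0 != 0)
  (vp : vanishes_on_param q0 q1 q2 p).

(** The same at infinity, through the reversed parametrization. *)
Lemma top_neq0_of_vanishes :
  (size q0 <= k.+1)%N -> (size q1 <= k.+1)%N -> (size q2 <= k.+1)%N ->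
  [|| q0`_k != 0, q1`_k != 0 | q2`_k != 0] -> (q1`_k != 0) || (q2`_k != 0).
Proof.
move=> s0 s1 s2 top; have [r0 vr] := vanishes_on_reverse q00 s0 s1 s2 vp.
have evC q : (map_poly (real_complex R) (reverse_poly k q)).[0] = real_complex R q`_k.
  by rewrite -(rmorph0 (real_complex R)) horner_map /= horner0_reverse.
have := no_common_root_of_vanishes p0 r0 vr (w := 0).
by rewrite !evC !fmorph_eq0; apply.
Qed.
End TopCoefficients.

(** * The curve as the zero set of a linear matrix pencil *)

Section LinearPencil.
Context {R : realType}.
Variables (k : nat) (q0 q1 q2 : {poly R}).
Hypotheses (s0 : (size q0 <= k.+1)%N) (s1 : (size q1 <= k.+1)%N)
  (s2 : (size q2 <= k.+1)%N).

Lemma bezoutian_Vandermonde (K : comNzRingType) (iota : {rmorphism R -> K}) n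
    (a : 'rV[K]_n) (f g : {poly R}) i j : (size f <= k.+1)%N -> (size g <= k.+1)%N ->
  (map_mx iota (bezoutian k f g) *m Vandermonde k a) i j =
  (bezout_at iota f g (a 0 j))`_i.
Proof.
move=> sf sg; rewrite mxE coef_map /= horner_evalE.
have sz : (size (map_poly iota (bezout_poly f g)`_i)%R <= k)%N.
  exact: leq_trans (size_poly _ _) (size_coef_bezout_poly _ sf sg).
rewrite (horner_coef_wide _ sz); apply: eq_bigr => l _.
by rewrite coef_map !mxE.
Qed.

(** The polynomials q1 - x q0 and q2 - y q0 have the common root u, so their
    Bezout polynomial vanishes when one variable is u. *)
Lemma pencil_ker (x y u : R) : q1.[u] = x * q0.[u] -> q2.[u] = y * q0.[u] ->
  pencil k q0 q1 q2 idfun x y *m Vandermonde k (const_mx u : 'rV_1) = 0.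
Proof.
move=> q1u q2u; apply/matrixP => i j; rewrite /pencil !mulmxBl -!scalemxAl.
have sub (A B D : 'M[R]_(k, 1)) :
    (A - y *: B - x *: D) i j = A i j - y * B i j - x * D i j.
  by rewrite !mxE.
rewrite sub !bezoutian_Vandermonde // mxE.
set b12 := bezout_at _ _ _ _; set b10 := bezout_at _ _ _ _.
set b02 := bezout_at _ _ _ _.
suff b0 : b12 - y *: b10 - x *: b02 = 0.
  have := congr1 (fun P : {poly R} => P`_i) b0.
  by rewrite /= !coefB !coefZ coef0 => ->; rewrite mxE.
have Xu0 : 'X - u%:P != 0 by rewrite polyXsubC_eq0.
apply: (mulIf Xu0); rewrite mul0r !mulrBl -!scalerAl !bezout_atE.
rewrite !map_poly_id // q1u q2u -!mul_polyC !polyCM; ring.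
Qed.

Lemma plane_eval_det_pencil (K : comNzRingType) (iota : {rmorphism R -> K}) x y :
  plane_eval iota x y (\det (pencil k q0 q1 q2 (@mpolyC 2 R) 'X_0 'X_1)) =
  \det (pencil k q0 q1 q2 iota x y).
Proof.
pose h : {rmorphism {mpoly R[2]} -> K} := plane_eval iota x y.
have hX i : h 'X_i = if i == 0 then x else y by rewrite /h /= /plane_eval mmapX mmap1U.
have hC c : h c%:MP = iota c by rewrite /h /= /plane_eval mmapC.
rewrite -[LHS]/(h _) -(det_map_mx h).
by rewrite (map_pencil (L := K) k q0 q1 q2 _ _ hC) !hX.
Qed.

Lemma det_pencil_vanishes : (0 < k)%N ->
  vanishes_on_param q0 q1 q2 (\det (pencil k q0 q1 q2 (@mpolyC 2 R) 'X_0 'X_1)).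
Proof.
move=> k0 u q0u; set z := param_point _ _ _ _.
rewrite -[LHS](plane_eval_real idfun z) plane_eval_det_pencil.
apply/eqP; rewrite -det_tr; apply/det0P.
exists (Vandermonde k (const_mx u : 'rV_1))^T.
  apply/eqP => /matrixP/(_ 0 (Ordinal k0)); rewrite !mxE expr0 => /eqP.
  by rewrite oner_eq0.
by rewrite -trmx_mul pencil_ker ?trmx0 // mxE /= divfK.
Qed.

Lemma msize_prod_linear n (F : 'I_n -> {mpoly R[2]}) :
  (forall i, msize (F i) <= 2)%N -> (msize (\prod_i F i) <= n.+1)%N.
Proof.
elim: n F => [|n IHn] F F2; first by rewrite big_ord0 msize1.
rewrite big_ord_recl; set P := \prod_i _; have sP : (msize P <= n.+1)%N by exact: IHn.
have [->|F0] := eqVneq (F ord0) 0; first by rewrite mul0r msize0.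
have [->|P0] := eqVneq P 0; first by rewrite mulr0 msize0.
rewrite msizeM // -subn1 leq_subLR.
exact: leq_add (F2 ord0) sP.
Qed.

Lemma msize_det_pencil :
  (msize (\det (pencil k q0 q1 q2 (@mpolyC 2 R) 'X_0%R 'X_1%R)) <= k.+1)%N.
Proof.
rewrite /determinant; apply: leq_trans (msize_sum _ _ _) _.
apply/bigmax_leqP => s _; rewrite mulr_sign.
have prod2 : (msize (\prod_i
    pencil k q0 q1 q2 (@mpolyC 2 R) 'X_0 'X_1 i (s i)) <= k.+1)%N.
  apply: msize_prod_linear => i; rewrite pencilE.
  have lin (j : 'I_2) c : (msize ('X_j * c%:MP_[2] : {mpoly R[2]}) <= 2)%N.
    by rewrite mulrC mul_mpolyC (leq_trans (msizeZ_le _ _)) // msizeX mdeg1.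
  rewrite (leq_trans (msizeD_le _ _)) // msizeN geq_max lin andbT.
  rewrite (leq_trans (msizeD_le _ _)) // msizeN geq_max lin andbT.
  by rewrite msizeC (leq_trans (leq_b1 _)).
by case: ifP => _; rewrite ?msizeN.
Qed.

End LinearPencil.

Section DeterminantalFormula.
Context {R : realType}.
Local Notation C := R[i].
Local Notation iota := (real_complex R).
Local Notation "f ^C" := (map_poly iota f) (format "f ^C").
Variables (p : {mpoly R[2]}) (k : nat) (q0 q1 q2 : {poly R}).
Hypotheses (k_gt0 : (0 < k)%N) (s0 : (size q0 <= k.+1)%N)
  (s1 : (size q1 <= k.+1)%N) (s2 : (size q2 <= k.+1)%N).
Hypothesis top_neq0 : (q1`_k != 0) || (q2`_k != 0).
Hypothesis no_common_root : forall w, (q1^C.[w] != 0) || (q2^C.[w] != 0).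

Lemma pencil0 (K : comNzRingType) (h : {rmorphism R -> K}) :
  pencil k q0 q1 q2 h 0 0 = map_mx h (bezoutian k q1 q2).
Proof. by rewrite /pencil !scale0r !subr0. Qed.

(** In a generic direction, the Bezoutian is congruent over the complex numbers
    to a diagonal matrix of nonzero values of the Wronskian. *)
Lemma det_bezoutian_neq0 : \det (bezoutian k q1 q2) != 0.
Proof.
have [u] := exists_generic_direction k_gt0 top_neq0 no_common_root [::].
set z1 := iota q1.[u]; set z2 := iota q2.[u]; case=> z0 lead good.
have [w /good[]//|a inja rts] := generic_line_roots s1 s2 z0 lead.
have sE i : exists s, q1^C.[a 0 i] = s * z1 /\ q2^C.[a 0 i] = s * z2.
  apply: colinear => //.
  have : root (line_poly q1 q2 z1 z2) (a 0 i) by apply/rts; exists i.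
  by rewrite rootE line_polyE subr_eq0 mulrC [X in _ == X]mulrC => /eqP.
have [s sz] := choice sE.
have := det_pencil_roots s1 s2 s0 0 inja sz.
rewrite !mul0r pencil0 det_map_mx => E.
have : \prod_i ((s i - 0 * q0^C.[a 0 i]) * slope q1 q2 z1 z2 (a 0 i)) != 0.
  apply/prodf_neq0 => i _; rewrite mul0r subr0.
  have [q1a q2a] := sz i; rewrite -(wronskian_slope q1a q2a).
  by have [] : (wronskian q1 q2)^C.[a 0 i] != 0 /\ a 0 i \notin [::]
    by apply: good; apply/rts; exists i.
by rewrite -E mulf_eq0 negb_or fmorph_eq0 => /andP[].
Qed.

Hypotheses (p0 : peval p 0 = 1) (irrp : mirreducible p) (q00 : q0 != 0)
  (nconst : ~ (exists a b, q1 = a *: q0 /\ q2 = b *: q0))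
  (vp : vanishes_on_param q0 q1 q2 p).

(** The determinant of the pencil is a nonzero multiple of p of degree at most k,
    and k is at most the degree of p. *)
Lemma det_pencilE : (k.+1 <= msize p)%N -> msize p = k.+1 /\
  \det (pencil k q0 q1 q2 (@mpolyC 2 R) 'X_0 'X_1) =
    \det (bezoutian k q1 q2) *: p.
Proof.
set N := \det _ => lekp.
have N0 : peval N 0 = \det (bezoutian k q1 q2).
  rewrite -[LHS](plane_eval_real idfun 0) plane_eval_det_pencil !mxE.
  rewrite /= pencil0; congr (\det _).
  by apply/matrixP => i j; rewrite !mxE.
have [h NE] : exists h, N = h * p.
  apply: (dvd_of_vanishes_on_param irrp q00 nconst vp).
  exact: det_pencil_vanishes.
have N_neq0 : N != 0.
  by apply: contra_eq_neq N0 => ->; rewrite /peval meval0 eq_sym det_bezoutian_neq0.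
have h0 : h != 0 by apply: contraNneq N_neq0 => h0; rewrite NE h0 mul0r.
have pn0 : p != 0 by apply: contraNneq N_neq0 => pn0; rewrite NE pn0 mulr0.
have : (msize N <= k.+1)%N by exact: msize_det_pencil.
have h_gt0 : (0 < msize h)%N by rewrite lt0n msize_poly_eq0.
rewrite NE msizeM // => le.
have /andP[sh sp] : (msize h <= 1)%N && (msize p <= k.+1)%N.
  by move: le lekp h_gt0; move: (msize h) (msize p) => a b; lia.
split; first by apply/eqP; rewrite eqn_leq sp lekp.
have := msize1_polyC sh; move: h@_0 => c hE.
rewrite -N0 NE hE mul_mpolyC; congr (_ *: _).
by rewrite /peval mevalZ -/(peval p 0) p0 mulr1.
Qed.

End DeterminantalFormula.

(** * The parametrization is reduced and of degree m *)

Section Normalization.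
Context {R : realType}.
Local Notation C := R[i].
Local Notation iota := (real_complex R).
Local Notation "f ^C" := (map_poly iota f) (format "f ^C").

Lemma vanishes_on_param_mulr p (d r0 r1 r2 : {poly R}) : d != 0 -> r0 != 0 ->
  vanishes_on_param (r0 * d) (r1 * d) (r2 * d) p -> vanishes_on_param r0 r1 r2 p.
Proof.
move=> d0 r00 vp; apply/(vanishes_on_param_homogenize _ _ _ r00).
apply: (poly_eq0_of_values (mulf_neq0 r00 d0)) => u r0du.
have := r0du; rewrite hornerM mulf_eq0 negb_or => /andP[r0u du].
rewrite horner_homogenize_real //.
rewrite (_ : param_point _ _ _ _ = param_point (r0 * d) (r1 * d) (r2 * d) u).
  by rewrite vp // mulr0.
by apply/rowP => i; rewrite !mxE !hornerM -!mulf_div divff // !mulr1.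
Qed.

Lemma gcd_quotients_no_common_root (q0 q1 q2 : {poly R}) (w : C) : q0 != 0 ->
  let d := gcdp q0 (gcdp q1 q2) in
  [|| (q0 %/ d)^C.[w] != 0, (q1 %/ d)^C.[w] != 0 | (q2 %/ d)^C.[w] != 0].
Proof.
move=> q00 /=; set d := gcdp _ _.
have d0 : d != 0 by rewrite gcdp_eq0 (negPf q00).
apply/negPn/negP; rewrite !negb_or !negbK => /and3P[r0w r1w r2w].
have dvd (q : {poly R}) : d %| q -> (q %/ d)^C.[w] == 0 -> ('X - w%:P) * d^C %| q^C.
  move=> dq qw; rewrite -(divpK dq) rmorphM /= dvdp_mul2r ?map_poly_eq0 //.
  by rewrite dvdp_XsubCl.
have d12 : d %| gcdp q1 q2 by exact: dvdp_gcdr.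
have dE : d^C = gcdp q0^C (gcdp q1^C q2^C) by rewrite !gcdp_map.
have : ('X - w%:P) * d^C %| d^C.
  rewrite {2}dE !dvdp_gcd !dvd //.
  - exact: dvdp_trans d12 (dvdp_gcdr _ _).
  - exact: dvdp_trans d12 (dvdp_gcdl _ _).
  - exact: dvdp_gcdl.
have dC0 : d^C != 0 by rewrite map_poly_eq0.
move=> /(dvdp_leq dC0); rewrite size_mul ?polyXsubC_eq0 // size_XsubC.
by rewrite add2n ltnn.
Qed.

Variables (m : nat) (p : {mpoly R[2]}) (q0 q1 q2 : {poly R}).
Hypotheses (sp : msize p = m.+1) (p0 : peval p 0 = 1) (irrp : mirreducible p)
  (s0 : (size q0 <= m.+1)%N) (s1 : (size q1 <= m.+1)%N) (s2 : (size q2 <= m.+1)%N)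
  (q00 : q0 != 0) (nconst : ~ (exists a b, q1 = a *: q0 /\ q2 = b *: q0))
  (vp : vanishes_on_param q0 q1 q2 p).

Lemma degree_gt0 : (0 < m)%N.
Proof. by have [] := irrp; rewrite sp ltnS. Qed.

(** For the quotients of q0, q1, q2 by their gcd, of degree k, the determinantal
    formula forces k = m; hence the gcd is constant. *)
Lemma top_and_no_common_root :
  ((q1`_m != 0) || (q2`_m != 0)) /\
  forall w, (q1^C.[w] != 0) || (q2^C.[w] != 0).
Proof.
pose d := gcdp q0 (gcdp q1 q2).
have d0 : d != 0 by rewrite gcdp_eq0 (negPf q00).
pose r0 := q0 %/ d; pose r1 := q1 %/ d; pose r2 := q2 %/ d.
have dd : d %| gcdp q1 q2 by exact: dvdp_gcdr.
have q0E : q0 = r0 * d by rewrite divpK ?dvdp_gcdl.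
have q1E : q1 = r1 * d by rewrite divpK // (dvdp_trans dd) ?dvdp_gcdl.
have q2E : q2 = r2 * d by rewrite divpK // (dvdp_trans dd) ?dvdp_gcdr.
have r00 : r0 != 0 by apply: contraNneq q00 => r00; rewrite q0E r00 mul0r.
have vr : vanishes_on_param r0 r1 r2 p.
  by apply: (vanishes_on_param_mulr d0) => //; rewrite -q0E -q1E -q2E.
have nocr w := no_common_root_of_vanishes p0 r00 vr
  (gcd_quotients_no_common_root q1 q2 w q00).
clearbody r0 r1 r2; have ncr : ~ (exists a b, r1 = a *: r0 /\ r2 = b *: r0).
  case=> a [b [r1E r2E]]; apply: nconst; exists a, b.
  by rewrite q1E q2E r1E r2E q0E -!scalerAl.
(* The size of a zero quotient is 0; the bound then comes from q0. *)
have dsz (q r : {poly R}) : q = r * d -> (size q <= m.+1)%N ->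
    (size r + size d <= m.+2)%N.
  move=> qE; have [->|rn0] := eqVneq r 0.
    move=> _; rewrite size_poly0 add0n -ltnS ltnS.
    have : (size d <= size q0)%N by rewrite dvdp_leq // dvdp_gcdl.
    by move/leq_trans/(_ s0); apply: leqW.
  rewrite qE size_mul //; have := d0; rewrite -size_poly_gt0.
  by move: (size r) (size d) => a b; lia.
pose k := (maxn (size r0) (maxn (size r1) (size r2))).-1.
have r0_gt0 : (0 < size r0)%N by rewrite size_poly_gt0.
have kE : maxn (size r0) (maxn (size r1) (size r2)) = k.+1.
  by rewrite prednK // leq_max r0_gt0.
clearbody k; have [t0 t1 t2] :
  [/\ (size r0 <= k.+1)%N, (size r1 <= k.+1)%N & (size r2 <= k.+1)%N].
  by rewrite -kE !leq_max !leqnn !orbT.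
have kd : (k.+1 + size d <= m.+2)%N.
  have := dsz _ _ q0E s0; have := dsz _ _ q1E s1; have := dsz _ _ q2E s2.
  by move: kE; move: (size r0) (size r1) (size r2) (size d) => *; lia.
have d_gt0 : (0 < size d)%N by rewrite size_poly_gt0.
have k_gt0 : (0 < k)%N.
  rewrite lt0n; apply/eqP => k0; apply: ncr.
  move: t0 t1 t2; rewrite k0 => /size1_polyC r0E /size1_polyC r1E /size1_polyC r2E.
  have r0c : r0`_0 != 0 by apply: contraNneq r00 => r0c; rewrite r0E r0c.
  exists (r1`_0 / r0`_0), (r2`_0 / r0`_0); rewrite {1}r1E {1}r2E r0E.
  by rewrite -!mul_polyC -!polyCM !coefC !eqxx !divfK.
have topr : [|| r0`_k != 0, r1`_k != 0 | r2`_k != 0].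
  apply/negPn/negP; rewrite !negb_or !negbK => /and3P[z0 z1 z2].
  have small (r : {poly R}) : (size r <= k.+1)%N -> r`_k == 0 -> (size r <= k)%N.
    by move=> sr /eqP rk; apply/leq_sizeP => j; rewrite leq_eqVlt
      => /orP[/eqP<-//|/(leq_sizeP _ _ sr)].
  have := small _ t0 z0; have := small _ t1 z1; have := small _ t2 z2.
  by move: kE; move: (size r0) (size r1) (size r2) => *; lia.
have top := top_neq0_of_vanishes p0 r00 vr t0 t1 t2 topr.
have [] := det_pencilE k_gt0 t0 t1 t2 top nocr p0 irrp r00 ncr vr.
  by rewrite sp; move: kd d_gt0; move: (size d) => *; lia.
rewrite sp => -[km] _.
have /size1_polyC dE : (size d <= 1)%N.
  by move: kd; rewrite km; move: (size d) => *; lia.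
have c0 : d`_0 != 0 by apply: contraNneq d0 => c0; rewrite dE c0.
rewrite q1E q2E km dE !coefMC !mulf_eq0 (negPf c0) !orbF; split=> // w.
rewrite !rmorphM /= !map_polyC !hornerM !hornerC !mulf_eq0 fmorph_eq0.
by rewrite (negPf c0) !orbF.
Qed.

Lemma det_pencil_param (K : comNzRingType) (h : {rmorphism R -> K}) x y :
  \det (pencil m q0 q1 q2 h x y) =
  h (\det (bezoutian m q1 q2)) * plane_eval h x y p.
Proof.
have [top noc] := top_and_no_common_root.
have [] := det_pencilE degree_gt0 s0 s1 s2 top noc p0 irrp q00 nconst vp.
  by rewrite sp.
move=> _ NE; rewrite -plane_eval_det_pencil NE.
by rewrite /plane_eval mmapZ.
Qed.

Lemma det_bezoutian_param_neq0 : \det (bezoutian m q1 q2) != 0.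
Proof.
have [top noc] := top_and_no_common_root.
exact: det_bezoutian_neq0 degree_gt0 s0 s1 s2 top noc.
Qed.

End Normalization.

(** * A definite Bezoutian gives real zeros *)

Section DefinitePencil.
Context {R : realType}.
Local Notation C := R[i].
Local Notation iota := (real_complex R).
Local Notation form A a := ((a *m A *m a^T) 0 0).

Lemma psd_form n (A : 'M[R]_n) (a : 'rV[R]_n) : psd A -> 0 <= form A a.
Proof. by case=> _ /(_ a^T); rewrite trmxK. Qed.

(** Otherwise the form would be negative at a - s aA for small positive s; with
    c the value of the form at aA, s = |aA|^2 / (c + 1) is small enough. *)
Lemma psd_form_eq0 n (A : 'M[R]_n) (a : 'rV[R]_n) :
  psd A -> form A a = 0 -> a *m A = 0.
Proof.
move=> psdA fa0; have [y yE] : exists y, a *m A = y by exists (a *m A).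
pose N := (y *m y^T) 0 0.
have Aa : A *m a^T = y^T by rewrite -yE trmx_mul psdA.1.
have expand s : form A (a + s *: y) = 2 * s * N + s ^+ 2 * form A y.
  have -> : (a + s *: y) *m A *m (a + s *: y)^T =
      a *m A *m a^T + s *: (y *m y^T) + s *: (y *m y^T) + s ^+ 2 *: (y *m A *m y^T).
    rewrite linearD linearZ /= !mulmxDl !mulmxDr -!scalemxAl -!scalemxAr.
    by rewrite -!mulmxA Aa !mulmxA yE !scalerA expr2 !addrA.
  have entry (P Q T : 'M[R]_1) : (P + s *: Q + s *: Q + s ^+ 2 *: T) 0 0 =
      P 0 0 + s * Q 0 0 + s * Q 0 0 + s ^+ 2 * T 0 0 by rewrite !mxE.
  by rewrite entry fa0 -/N; ring.
have c0 := psd_form y psdA; set c := form A y in expand c0.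
have N0 : 0 <= N by rewrite /N mxE sumr_ge0 // => i _; rewrite mxE -expr2 sqr_ge0.
have := psd_form (a + (- (N / (c + 1))) *: y) psdA; rewrite expand -/c => ge0.
(* The denominator c + 1 avoids the case c = 0. *)
have c1 : c + 1 != 0 by rewrite gt_eqF // ltr_wpDl.
have E : 2 * - (N / (c + 1)) * N + (- (N / (c + 1))) ^+ 2 * c =
   - ((N / (c + 1)) ^+ 2 * (c + 2)) by field.
move: ge0; rewrite E oppr_ge0 => le0.
have /eqP : (N / (c + 1)) ^+ 2 * (c + 2) = 0.
  by apply/eqP; rewrite eq_le le0 mulr_ge0 ?sqr_ge0 // addr_ge0.
rewrite mulf_eq0 sqrf_eq0 mulf_eq0 invr_eq0 (negPf c1) orbF.
move=> /orP[/eqP NE|]; last first.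
  by rewrite gt_eqF // ltr_wpDl.
apply/rowP => i; rewrite [RHS]mxE yE; apply/eqP; rewrite -sqrf_eq0.
move: NE; rewrite /N mxE => /eqP; rewrite psumr_eq0; last first.
  by move=> j _; rewrite mxE -expr2 sqr_ge0.
by move=> /allP/(_ i); rewrite mem_index_enum mxE -expr2 => /(_ isT).
Qed.

Lemma mx11_combination (K : comNzRingType) (e c : K) (P Q Q' T : 'M[K]_1) :
  (P - e *: Q + (e *: Q' - c *: T)) 0 0 =
  P 0 0 - e * Q 0 0 + (e * Q' 0 0 - c * T 0 0).
Proof. by rewrite !mxE. Qed.

Lemma map_mx11 (K L : nzRingType) (h : K -> L) (P : 'M[K]_1) :
  (map_mx h P) 0 0 = h (P 0 0).
Proof. by rewrite mxE. Qed.

Lemma complex_form n (M : 'M[R]_n) (a b : 'rV[R]_n) : M^T = M ->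
  let v := map_mx iota a + 'i%C *: map_mx iota b in
  let w := map_mx iota a - 'i%C *: map_mx iota b in
  (v *m map_mx iota M *m w^T) 0 0 = iota (form M a + form M b).
Proof.
move=> symM v w.
have sym : b *m M *m a^T = (a *m M *m b^T)^T by rewrite !trmx_mul trmxK symM mulmxA.
rewrite /v /w linearB linearZ /= !map_trmx !mulmxDl !mulmxBr -!scalemxAl -!scalemxAr.
rewrite -!map_mxM sym scalerA.
rewrite mx11_combination !map_mx11 [_^T 0 0]mxE -expr2 sqr_i mulN1r opprK addrA subrK.
by rewrite rmorphD.
Qed.

(** Pairing a kernel vector v with its conjugate gives v A v* = t v S v* with both
    forms real; if t is not real, both vanish, and then so does v. *)
Lemma definite_pencil_real_root n (A S : 'M[R]_n) (t : C) :
  psd A -> S^T = S -> \det A != 0 ->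
  \det (map_mx iota A - t *: map_mx iota S) = 0 -> complex.Im t = 0.
Proof.
move=> psdA symS detA /eqP/det0P[v v0 vM].
pose a := map_mx (@complex.Re R) v; pose b := map_mx (@complex.Im R) v.
have vE : v = map_mx iota a + 'i%C *: map_mx iota b.
  by apply/rowP => i; rewrite !mxE; exact: complexE.
clearbody a b; apply/eqP; apply/negPn/negP => t0.
pose w := map_mx iota a - 'i%C *: map_mx iota b.
have : (v *m (map_mx iota A - t *: map_mx iota S) *m w^T) 0 0 = 0.
  by rewrite vM mul0mx mxE.
rewrite mulmxBr mulmxBl -scalemxAr -scalemxAl mxE [X in _ + X]mxE [X in _ - X]mxE.
rewrite {1 2}vE !complex_form //; last exact: psdA.1.
set x := form A a + form A b; set y := form S a + form S b => E.
have y0 : y = 0.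
  have := congr1 (@complex.Im R) E; case: (t) t0 => t1 t2 /= t20.
  by simpc => /= /eqP; rewrite oppr_eq0 mulf_eq0 (negPf t20) => /eqP.
have x0 : x = 0.
  move: E; rewrite y0 rmorph0 mulr0 subr0 => /eqP.
  by rewrite fmorph_eq0 => /eqP.
have ga := psd_form a psdA; have gb := psd_form b psdA.
have fa : form A a = 0 by move: x0 ga gb; rewrite /x; lra.
have fb : form A b = 0 by move: x0 ga gb; rewrite /x; lra.
have unitA : A \in unitmx by rewrite unitmxE unitfE.
have kill (c : 'rV[R]_n) : c *m A = 0 -> c = 0.
  by move=> cA; rewrite -(mulmxK unitA c) cA mul0mx.
have a0 : a = 0 by exact/kill/psd_form_eq0.
have b0 : b = 0 by exact/kill/psd_form_eq0.
by move: v0; rewrite vE a0 b0 map_mx0 scaler0 addr0 eqxx.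
Qed.

Lemma line_restrictionE (p : {mpoly R[2]}) (z : 'rV[R]_2) (t : C) :
  (map_poly iota (line_restriction p z)).[t] =
  plane_eval iota (t * iota (z 0 0)) (t * iota (z 0 1)) p.
Proof.
rewrite -[LHS]/((horner_eval t \o map_poly iota) (line_restriction p z)).
rewrite /line_restriction rmorph_mmap; apply: eq_mmap => [c|i] /=.
  by rewrite map_polyC horner_evalE hornerC.
rewrite linearZ /= map_polyX horner_evalE hornerZ hornerX mulrC.
case: i => -[|[|//]] lti /=; congr (_ * iota (z _ _)); exact: val_inj.
Qed.

End DefinitePencil.

Section Sufficiency.
Context {R : realType}.
Local Notation C := R[i].
Local Notation iota := (real_complex R).
Variables (m : nat) (p : {mpoly R[2]}) (q0 q1 q2 : {poly R}).
Hypotheses (sp : msize p = m.+1) (p0 : peval p 0 = 1) (irrp : mirreducible p)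
  (s0 : (size q0 <= m.+1)%N) (s1 : (size q1 <= m.+1)%N) (s2 : (size q2 <= m.+1)%N)
  (q00 : q0 != 0) (nconst : ~ (exists a b, q1 = a *: q0 /\ q2 = b *: q0))
  (vp : vanishes_on_param q0 q1 q2 p).

Lemma real_zero_of_psd :
  psd (bezoutian m q1 q2) \/ psd (- bezoutian m q1 q2) -> real_zero p.
Proof.
move=> psdB z _ t; rewrite rootE line_restrictionE => /eqP pt0.
have detB := det_bezoutian_param_neq0 sp p0 irrp s0 s1 s2 q00 nconst vp.
have := det_pencil_param sp p0 irrp s0 s1 s2 q00 nconst vp iota
  (t * iota (z 0 0)) (t * iota (z 0 1)).
rewrite pt0 mulr0 => det0.
pose B := bezoutian m q1 q2.
pose S := z 0 1 *: bezoutian m q1 q0 + z 0 0 *: bezoutian m q0 q2.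
have pE : pencil m q0 q1 q2 iota (t * iota (z 0 0)) (t * iota (z 0 1)) =
    map_mx iota B - t *: map_mx iota S.
  rewrite /pencil /S map_mxD !map_mxZ scalerDr !scalerA opprD addrA //.
have symS : S^T = S by rewrite linearD !linearZ /= !trmx_bezoutian.
rewrite pE in det0; case: psdB => psdB; first exact: definite_pencil_real_root det0.
have symNS : (- S)^T = - S by rewrite linearN /= symS.
apply: (definite_pencil_real_root psdB symNS).
  by rewrite -scaleN1r detZ mulf_neq0 ?expf_neq0 ?oppr_eq0 ?oner_eq0.
rewrite !map_mxN scalerN opprK addrC -opprB -scaleN1r detZ.
by rewrite det0 mulr0.
Qed.
End Sufficiency.

(** * The Euler operator, and real zeros in all directions *)

Section Euler.
Context {R : realType}.
Local Notation C := R[i].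
Local Notation iota := (real_complex R).
Implicit Types p : {mpoly R[2]}.

(** The radial derivative x dp/dx + y dp/dy, a combination of the monomials of p
    weighted by degree. *)
Definition euler p : {mpoly R[2]} :=
  \sum_(m <- msupp p) (p@_m *+ mdeg m) *: 'X_[m].

Lemma mcoeff_euler p m : (euler p)@_m = p@_m *+ mdeg m.
Proof.
rewrite /euler raddf_sum /=; have [mp|mp] := boolP (m \in msupp p).
  rewrite (bigD1_seq m) ?msupp_uniq //= mcoeffZ mcoeffX eqxx mulr1 big1 ?addr0 //.
  by move=> m' nm; rewrite mcoeffZ mcoeffX (negPf nm) mulr0.
rewrite (memN_msupp_eq0 mp) mul0rn big_seq big1 // => m' m'p.
rewrite mcoeffZ mcoeffX; case: eqP => [mm|_]; last by rewrite mulr0.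
by rewrite mm (negPf mp) in m'p.
Qed.

Lemma msize_euler p : (msize (euler p) <= msize p)%N.
Proof.
rewrite msizeE big_seq; elim/big_ind: _ => // [a b la lb|m].
  by rewrite geq_max la.
rewrite mcoeff_msupp mcoeff_euler => me; apply: msize_mdeg_lt.
by rewrite mcoeff_msupp; apply: contraNneq me => ->; rewrite mul0rn.
Qed.

Lemma line_restriction_monomials p z : line_restriction p z =
  \sum_(m <- msupp p) (p@_m * (z 0 0 ^+ m 0 * z 0 1 ^+ m 1)) *: 'X^(mdeg m).
Proof.
rewrite -[LHS]/(mmap (@polyC R) (fun i => z 0 i *: 'X) p).
apply: eq_bigr => m _; rewrite /mmap1 !big_ord_recl big_ord0 mulr1 mul_polyC.
rewrite !exprZn -scalerAl -scalerAr !scalerA -exprD mdeg2 -mulrA.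
by congr ((_ * (z _ _ ^+ m _ * z _ _ ^+ m _)) *: 'X^(m _ + m _)); apply: val_inj.
Qed.

Lemma line_restriction_euler p z :
  line_restriction (euler p) z = 'X * (line_restriction p z)^`().
Proof.
have lin c g : line_restriction (c *: g) z = c *: line_restriction g z.
  by rewrite /line_restriction mmapZ mul_polyC.
have sum_lr : line_restriction (euler p) z = \sum_(m <- msupp p)
    line_restriction ((p@_m *+ mdeg m) *: 'X_[m]) z.
  exact: (raddf_sum (mmap (@polyC R) (fun i => z 0 i *: 'X))).
rewrite sum_lr line_restriction_monomials raddf_sum mulr_sumr.
apply: eq_bigr => m _ /=; rewrite lin line_restriction_monomials msuppX big_seq1.
have XZ c (f : {poly R}) : 'X * (c *: f) = c *: ('X * f) by rewrite -scalerAr.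
rewrite mcoeffX eqxx mul1r scalerA derivZ derivXn XZ.
case: (mdeg m) => [|d]; first by rewrite !mulr0n mul0r mulr0 scale0r scaler0.
by rewrite /= mulrnAr -exprS mulrnAl -scalerMnl scalerMnr.
Qed.

(** The degree of euler p is at most that of p, so divisibility by p would make it
    a constant multiple of p; it vanishes at the origin and p does not, so it is
    0 and p is constant. *)
Lemma euler_nvanishes p (q0 q1 q2 : {poly R}) : mirreducible p ->
  peval p 0 = 1 -> q0 != 0 -> ~ (exists a b, q1 = a *: q0 /\ q2 = b *: q0) ->
  vanishes_on_param q0 q1 q2 p -> ~ vanishes_on_param q0 q1 q2 (euler p).
Proof.
move=> irrp p0 q00 nconst vp ve.
have [h hE] := dvd_of_vanishes_on_param irrp q00 nconst vp ve.
have pn0 : p != 0.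
  apply/eqP => pn0; move: p0; rewrite pn0 /peval meval0 => /eqP.
  by rewrite eq_sym oner_eq0.
have origin g : peval g 0 = (line_restriction g 0).[0].
  rewrite -[LHS](plane_eval_real idfun) -[RHS]/((horner_eval 0 \o idfun) _).
  rewrite [RHS]rmorph_mmap; apply: eq_mmap => [c|i] /=.
    by rewrite horner_evalE hornerC.
  by rewrite !mxE scale0r horner_evalE horner0; case: ifP.
have e0 : peval (euler p) 0 = 0.
  by rewrite origin line_restriction_euler hornerM hornerX mul0r.
have h0 : h = 0.
  apply/eqP; apply/negPn/negP => h0; have := msize_euler p.
  have : (0 < msize p)%N by rewrite lt0n msize_poly_eq0.
  rewrite hE msizeM // => sp le.
  have /msize1_polyC : (msize h <= 1)%N.
    by move: sp le; move: (msize h) (msize p) => a b; lia.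
  move: h@_0 => c hc; move: e0; rewrite hE hc mul_mpolyC /peval mevalZ -/(peval p 0).
  by rewrite p0 mulr1 => c0; move: h0; rewrite hc c0 eqxx.
have [sp _] := irrp; suff : (msize p <= 1)%N by rewrite leqNgt sp.
rewrite msizeE big_seq; elim/big_ind: _ => // [a b la lb|m mp].
  by rewrite geq_max la.
have := mcoeff_euler p m; rewrite hE h0 mul0r mcoeff0 => /esym/eqP.
by rewrite mulrn_eq0 mcoeff_eq0 mp orbF => /eqP ->.
Qed.

Lemma horner_line_euler p (z : 'rV[R]_2) (t : C) :
  plane_eval iota (t * iota (z 0 0)) (t * iota (z 0 1)) (euler p) =
  t * (map_poly iota (line_restriction p z))^`().[t].
Proof.
by rewrite -line_restrictionE line_restriction_euler rmorphM /= map_polyX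
  hornerM hornerX deriv_map.
Qed.

Lemma deriv_double_root (A B D : {poly C}) t :
  A.[t] = 0 -> B.[t] = 0 -> (A * B * D)^`().[t] = 0.
Proof.
by move=> A0 B0; rewrite !derivM !(hornerD, hornerM) A0 B0 !(mulr0, mul0r, addr0).
Qed.

Lemma Im_mulr_real (t : C) (x : R) : complex.Im (t * iota x) = complex.Im t * x.
Proof. by case: t => a b; simpc. Qed.

Lemma Re_mulr_real (t : C) (x : R) : complex.Re (t * iota x) = complex.Re t * x.
Proof. by case: t => a b; simpc. Qed.

Lemma real_zero_direction p : real_zero p -> forall z : 'rV[R]_2, z != 0 ->
  real_rooted (line_restriction p z).
Proof.
move=> rz z z0 t; rewrite rootE line_restrictionE => /eqP pt.
pose n2 := \sum_i z 0 i ^+ 2; have n2_gt0 : 0 < n2.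
  rewrite lt_def sumr_ge0 ?andbT => [|i _]; last exact: sqr_ge0.
  apply: contra z0; rewrite psumr_eq0 => [|i _]; last exact: sqr_ge0.
  move=> /allP za; apply/eqP/rowP => i; rewrite [RHS]mxE; apply/eqP.
  by rewrite -sqrf_eq0; apply: za; rewrite mem_index_enum.
pose n := Num.sqrt n2; have n0 : n != 0 by rewrite gt_eqF // sqrtr_gt0.
have unit : \sum_i ((n^-1 *: z) 0 i) ^+ 2 = 1.
  under eq_bigr do rewrite mxE exprMn; rewrite -mulr_sumr -/n2 exprVn.
  by rewrite sqr_sqrtr ?mulVf ?gt_eqF // ltW.
have root : root (map_poly iota (line_restriction p (n^-1 *: z))) (t * iota n).
  rewrite rootE line_restrictionE -pt !mxE; apply/eqP; congr plane_eval;
  by rewrite -mulrA -rmorphM mulVKf.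
have /eqP := rz _ unit _ root.
by rewrite Im_mulr_real mulf_eq0 (negPf n0) orbF => /eqP.
Qed.
End Euler.

(** * Conjugate parameters of the same real point *)

Section Exceptional.
Context {R : realType}.
Local Notation C := R[i].
Local Notation iota := (real_complex R).
Local Notation "f ^C" := (map_poly iota f) (format "f ^C").
Variables (m : nat) (p : {mpoly R[2]}) (q0 q1 q2 : {poly R}).
Hypotheses (sp : msize p = m.+1) (p0 : peval p 0 = 1) (irrp : mirreducible p)
  (s0 : (size q0 <= m.+1)%N) (s1 : (size q1 <= m.+1)%N) (s2 : (size q2 <= m.+1)%N)
  (q00 : q0 != 0) (nconst : ~ (exists a b, q1 = a *: q0 /\ q2 = b *: q0))
  (vp : vanishes_on_param q0 q1 q2 p).

(** This is p (t z) = prod (1 - t q0(a_i) / s_i) with denominators cleared: the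
    ratio of the determinants of the diagonalized pencil at t and at 0. *)
Lemma line_restriction_factor (z : 'rV[R]_2) (a : 'rV[C]_m) (s : 'I_m -> C) :
  injective (a 0) ->
  (forall i, q1^C.[a 0 i] = s i * iota (z 0 0) /\ q2^C.[a 0 i] = s i * iota (z 0 1)) ->
  (forall i, (wronskian q1 q2)^C.[a 0 i] != 0) ->
  (\prod_i s i)%:P * (line_restriction p z)^C =
  \prod_i ((s i)%:P - q0^C.[a 0 i] *: 'X).
Proof.
move=> inja sz W; apply/eqP; rewrite -subr_eq0; apply/eqP.
apply: (@poly_eq0_of_values (R[i] : numDomainType) _ 1) => [|t _].
  exact: oner_neq0.
rewrite hornerD hornerN hornerM hornerC line_restrictionE horner_prod.
apply/eqP; rewrite subr_eq0; apply/eqP.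
have dt := det_pencil_roots s1 s2 s0 t inja sz.
have d0 := det_pencil_roots s1 s2 s0 0 inja sz.
have pe := det_pencil_param sp p0 irrp s0 s1 s2 q00 nconst vp iota.
rewrite pe big_split /= in dt; rewrite !mul0r pencil0 det_map_mx big_split /= in d0.
set S := \prod_i slope _ _ _ _ _ in dt d0.
have S0 : S != 0.
  apply/prodf_neq0 => i _; have [q1a q2a] := sz i.
  by apply: contraNneq (W i) => si; rewrite (wronskian_slope q1a q2a) si mulr0.
have dE : \prod_i (s i - 0 * q0^C.[a 0 i]) = \prod_i s i.
  by apply: eq_bigr => i _; rewrite mul0r subr0.
apply: (mulIf S0); rewrite -mulrA [_ * S]mulrC mulrA -dE -d0 -mulrA dt.
congr (_ * _); apply: eq_bigr => i _.
by rewrite hornerD hornerN hornerC hornerZ hornerX mulrC.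
Qed.

Lemma conjc_mul_real (s : C) (x : R) : (s * iota x)^*%C = s^*%C * iota x.
Proof. by case: s => a b; simpc. Qed.

Lemma horner_conj (f : {poly R}) (w : C) : f^C.[w^*%C] = (f^C.[w])^*%C.
Proof.
rewrite -horner_map; congr (_.[_]); rewrite -map_poly_comp.
by apply: eq_map_poly => c; exact: esym (conjc_real c).
Qed.

Lemma plane_eval_param (w : C) : q0^C.[w] != 0 ->
  plane_eval iota (q1^C.[w] / q0^C.[w]) (q2^C.[w] / q0^C.[w]) p = 0.
Proof.
move=> q0w; have := horner_homogenize q1 q2 p q0w.
have /vanishes_on_param_homogenize -> // := vp.
rewrite rmorph0 horner0 => /esym/eqP; rewrite mulf_eq0 expf_eq0 (negPf q0w) andbF.
by move/eqP.
Qed.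

(** The parameters u and conj u lie on the same real line through the origin.  If
    p has real zeros only, both have the same abscissa t on that line, so that t is
    a double root of the restriction of p to the line, and the radial derivative
    vanishes there. *)
Lemma euler_at_conjugate_pair (z : 'rV[R]_2) (u s : C) :
  real_zero p -> z != 0 -> complex.Im u != 0 -> q0^C.[u] != 0 ->
  q1^C.[u] = s * iota (z 0 0) -> q2^C.[u] = s * iota (z 0 1) ->
  iota (z 0 1) * iota q1`_m - iota (z 0 0) * iota q2`_m != 0 ->
  (forall w, root (line_poly q1 q2 (iota (z 0 0)) (iota (z 0 1))) w ->
    (wronskian q1 q2)^C.[w] != 0) ->
  (homogenize q0 q1 q2 (euler p))^C.[u] = 0.
Proof.
move=> rz z0 imu q0u q1u q2u lead W.
have [top noc] := top_and_no_common_root sp p0 irrp s0 s1 s2 q00 nconst vp.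
have z00 : (iota (z 0 0) != 0) || (iota (z 0 1) != 0).
  rewrite !fmorph_eq0 -negb_and; apply: contra z0 => /andP[/eqP z0 /eqP z1].
  apply/eqP/rowP => i; rewrite [RHS]mxE.
  case: i => -[|[|//]] lti; [rewrite -[RHS]z0|rewrite -[RHS]z1];
    by congr (z _ _); apply: val_inj.
have [a inja rts] := generic_line_roots s1 s2 z00 lead W.
have aroot i : root (line_poly q1 q2 (iota (z 0 0)) (iota (z 0 1))) (a 0 i).
  by apply/rts; exists i.
have sE i : exists s,
    q1^C.[a 0 i] = s * iota (z 0 0) /\ q2^C.[a 0 i] = s * iota (z 0 1).
  apply: colinear => //; have := aroot i.
  by rewrite rootE line_polyE subr_eq0 mulrC [X in _ == X]mulrC => /eqP.
have [sg sgE] := choice sE.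
have uniq_s (x y : C) : x * iota (z 0 0) = y * iota (z 0 0) ->
    x * iota (z 0 1) = y * iota (z 0 1) -> x = y.
  by case/orP: z00 => zn0 e1 e2; [exact: (mulIf zn0 e1)|exact: (mulIf zn0 e2)].
have uroot : root (line_poly q1 q2 (iota (z 0 0)) (iota (z 0 1))) u.
  rewrite rootE line_polyE q1u q2u subr_eq0.
  by rewrite mulrCA [X in _ == X]mulrCA [X in _ * X == _]mulrC.
have q1cu : q1^C.[u^*%C] = s^*%C * iota (z 0 0).
  by rewrite horner_conj q1u conjc_mul_real.
have q2cu : q2^C.[u^*%C] = s^*%C * iota (z 0 1).
  by rewrite horner_conj q2u conjc_mul_real.
have curoot : root (line_poly q1 q2 (iota (z 0 0)) (iota (z 0 1))) u^*%C.
  rewrite rootE line_polyE q1cu q2cu subr_eq0.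
  by rewrite mulrCA [X in _ == X]mulrCA [X in _ * X == _]mulrC.
have [i ui] := (rts u).1 uroot; have [j uj] := (rts u^*%C).1 curoot.
have si : sg i = s.
  by have [e1 e2] := sgE i; apply: uniq_s; [rewrite -e1 -ui|rewrite -e2 -ui].
have sj : sg j = s^*%C.
  by have [e1 e2] := sgE j; apply: uniq_s; [rewrite -e1 -uj|rewrite -e2 -uj].
have nij : j != i.
  apply: contra imu => /eqP ij; move: uj; rewrite ij -ui; case: (u) => x y [] /esym/eqP.
  by rewrite -addr_eq0 -mulr2n mulrn_eq0.
(* The point of parameter u is t z. *)
pose t := s / q0^C.[u].
have tq : s = t * q0^C.[u] by rewrite /t divfK.
have tz x : t * iota x = s * iota x / q0^C.[u] by rewrite /t mulrAC.
have evt g : plane_eval iota (t * iota (z 0 0)) (t * iota (z 0 1)) g =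
    plane_eval iota (q1^C.[u] / q0^C.[u]) (q2^C.[u] / q0^C.[u]) g.
  by rewrite q1u q2u !tz.
have imt : complex.Im t = 0.
  apply: (real_zero_direction rz z0).
  by rewrite rootE line_restrictionE evt plane_eval_param.
have ct : t^*%C = t by move: imt; case: (t) => x y /= ->; rewrite oppr0.
(* As t is real, it is also the coordinate of the point of parameter conj u. *)
have tcq : s^*%C = t * q0^C.[u^*%C] by rewrite {1}tq rmorphM /= ct horner_conj.
have LE := line_restriction_factor inja sgE (fun i => W _ (aroot i)).
have : ((\prod_i sg i)%:P * (line_restriction p z)^C)^`().[t] = 0.
  rewrite LE (bigD1 i) //= (bigD1 j) //= mulrA; apply: deriv_double_root.
    by rewrite hornerD hornerN hornerC hornerZ hornerX si -ui tq mulrC subrr.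
  by rewrite hornerD hornerN hornerC hornerZ hornerX sj -uj tcq mulrC subrr.
have sg0 : \prod_i sg i != 0.
  apply/prodf_neq0 => k _; have [e1 e2] := sgE k.
  by apply: contraTneq (noc (a 0 k)) => sk; rewrite e1 e2 sk !mul0r eqxx.
rewrite derivM derivC mul0r add0r hornerM hornerC => /eqP.
rewrite mulf_eq0 (negPf sg0) /= => /eqP L't.
by rewrite (horner_homogenize _ _ _ q0u) -evt horner_line_euler L't !mulr0.
Qed.

End Exceptional.

(** * The sign of the Wronskian *)

Section RealDirection.
Context {R : realType}.
Local Notation C := R[i].
Local Notation iota := (real_complex R).

Lemma real_ratio (x y : C) : complex.Im (x * y^*%C) = 0 -> (x != 0) || (y != 0) ->
  exists2 z : 'rV[R]_2, z != 0 &
    exists s, x = s * iota (z 0 0) /\ y = s * iota (z 0 1).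
Proof.
move=> imxy xy0.
have mk (z1 z2 : R) (s : C) : x = s * iota z1 -> y = s * iota z2 ->
  exists2 z : 'rV[R]_2, z != 0 &
    exists s, x = s * iota (z 0 0) /\ y = s * iota (z 0 1).
  move=> xE yE; exists (\row_i (if i == 0 then z1 else z2)).
    apply: contraTneq xy0 => /rowP z0; have := z0 0; have := z0 1; rewrite !mxE /=.
    by move=> z20 z10; rewrite xE yE z10 z20 rmorph0 !mulr0 eqxx.
  by exists s; rewrite !mxE.
have [x0|x0] := eqVneq x 0.
  by apply: (mk 0 1 y); rewrite ?rmorph0 ?rmorph1 ?mulr0 ?mulr1.
apply: (mk 1 (complex.Re (y / x)) x); first by rewrite rmorph1 mulr1.
suff im0 : complex.Im (y / x) = 0.
  have {im0} -> : iota (complex.Re (y / x)) = y / x.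
    by move: im0; case: (y / x) => a b /= ->.
  by rewrite mulrC divfK.
move: imxy x0; case: (x) => a b; case: (y) => c d; rewrite eq_complex /=.
simpc => /= e _.
have -> : - (c * (b / (a ^+ 2 + b ^+ 2))) + d * (a / (a ^+ 2 + b ^+ 2)) =
  - ((- (a * d) + b * c) / (a ^+ 2 + b ^+ 2)) by ring.
by rewrite e mul0r oppr0.
Qed.

Lemma real_part_poly (P : {poly C}) :
  exists Q : {poly R}, forall t, Q.[t] = complex.Re P.[iota t].
Proof.
exists (\poly_(i < size P) complex.Re P`_i) => t.
rewrite horner_poly horner_coef.
have Re_sum n (F : 'I_n -> C) : complex.Re (\sum_i F i) = \sum_i complex.Re (F i).
  by apply: (big_morph (@complex.Re R)) => // -[a b] [c d].
by rewrite Re_sum; apply: eq_bigr => i _; rewrite -rmorphXn Re_mulr_real.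
Qed.

Lemma horner_pos_near (Q : {poly R}) : 0 < Q.[0] ->
  exists2 d, 0 < d & forall e, 0 < e -> e < d -> 0 < Q.[e].
Proof.
move=> Q0; have [d d0 dQ] := poly_cont 0 Q Q0.
exists d => // e e0 ed; have := dQ e; rewrite subr0 (gtr0_norm e0) => /(_ ed).
by rewrite ltr_distl subrr => /andP[].
Qed.

Lemma exists_small_notin (s : seq R) d : 0 < d ->
  exists2 e, 0 < e < d & e \notin s.
Proof.
move=> d0.
(* The factor of c vanishes at n when c = d / (n + 2); the shift by 2 makes
   d / (n + 2) less than d for all n. *)
pose Q := \prod_(c <- s) (c *: ('X + 2%:P) - d%:P).
have Q0 : Q != 0.
  rewrite prodf_seq_neq0; apply/allP => c _ /=; apply: contraTneq d0.
  move=> /(congr1 (fun P : {poly R} => P.[- 2])).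
  rewrite hornerD hornerN hornerZ hornerD hornerX !hornerC addNr mulr0 add0r.
  by move/eqP; rewrite oppr_eq0 => /eqP ->; rewrite ltxx.
have [n] := exists_nonroot_nat Q0.
rewrite horner_prod prodf_seq_neq0 => /allP nz.
have n2 : 0 < n%:R + 2 :> R by rewrite ltr_wpDl.
exists (d / (n%:R + 2)).
  rewrite divr_gt0 //= ltr_pdivrMr // ltr_pMr // ltr_wpDl //.
  by rewrite ltr1n.
apply/negP => /nz /=; rewrite hornerD hornerN hornerZ hornerD hornerX !hornerC.
by rewrite divfK ?subrr ?eqxx // gt_eqF.
Qed.

End RealDirection.

Section WronskianSign.
Context {R : realType}.
Local Notation C := R[i].
Local Notation iota := (real_complex R).
Local Notation "f ^C" := (map_poly iota f) (format "f ^C").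
Variables (m : nat) (q1 q2 : {poly R}).
Hypotheses (s1 : (size q1 <= m.+1)%N) (s2 : (size q2 <= m.+1)%N).

Let bez (x y : C) : C := (bezout_at iota q1 q2 y).[x].

Lemma bezout_real_part_poly (A B : {poly C}) :
  exists Q : {poly R}, forall t, Q.[t] = complex.Re (bez A.[iota t] B.[iota t]).
Proof.
have [Q QE] := real_part_poly (\sum_(k < m) \sum_(l < m)
  A ^+ k * (iota (bezoutian m q1 q2 k l))%:P * B ^+ l).
exists Q => t; rewrite QE /bez (bezout_at_sum iota _ _ s1 s2) horner_sum.
congr complex.Re; apply: eq_bigr => k _; rewrite horner_sum.
by apply: eq_bigr => l _; rewrite !hornerM !horner_exp hornerC.
Qed.

(** The value at (u, conj u) times 2 i Im u is
    q1(u) conj(q2(u)) - conj(q1(u)) q2(u). *)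
Lemma bezout_conj_eq0 (u : C) : complex.Re (bez u u^*%C) = 0 ->
  complex.Im (q1^C.[u] * (q2^C.[u])^*%C) = 0.
Proof.
have := bezout_at_offdiag iota q1 q2 u u^*%C; rewrite -/(bez _ _) !horner_conj.
case: (bez _ _) => a b; case: (u) => x y; case: (q1^C.[_]) => c d.
case: (q2^C.[_]) => e f /=; simpc => -[h1 h2] a0; rewrite a0 in h1 h2.
by move: h2; rewrite mul0r; lra.
Qed.

Lemma bezout_diag_real (x : R) :
  complex.Re (bez (iota x) (iota x)) = (wronskian q1 q2).[x].
Proof. by rewrite /bez bezout_at_diag horner_map. Qed.

Variable Q : {poly C}.
Hypothesis Q0 : Q != 0.
Hypothesis balanced : forall u : C, complex.Im u != 0 ->
  complex.Im (q1^C.[u] * (q2^C.[u])^*%C) = 0 -> Q.[u] = 0.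

(** Slightly above the real line, the real part of the value at (u, conj u) keeps
    the sign of the Wronskian.  A change of sign would give, on a horizontal line
    that avoids the roots of Q, a parameter excluded by the hypothesis on Q. *)
Lemma wronskian_sign_constant :
  (forall x, 0 <= (wronskian q1 q2).[x]) \/ (forall x, (wronskian q1 q2).[x] <= 0).
Proof.
suff opposite x y : 0 < (wronskian q1 q2).[x] -> (wronskian q1 q2).[y] < 0 -> False.
  have [|/existsNP[y /negP]] := pselect (forall x, 0 <= (wronskian q1 q2).[x]).
    by left.
  rewrite -ltNge => Wy; right => x; rewrite leNgt; apply/negP => Wx.
  exact: opposite Wx Wy.
move=> Wx Wy.
(* On the vertical line through z the values at (u, conj u) are polynomial in
   the height e, and continue to the real line by bezout_diag_real. *)
have vertical (z : R) : exists P : {poly R}, forall e,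
    P.[e] = complex.Re (bez (iota z + 'i%C * iota e) (iota z - 'i%C * iota e)).
  have [P PE] := bezout_real_part_poly
    ((iota z)%:P + 'i%C *: 'X) ((iota z)%:P - 'i%C *: 'X).
  exists P => e; rewrite PE !(hornerD, hornerN, hornerZ, hornerX, hornerC).
  by [].
have at0 z P : (forall e,
      P.[e] = complex.Re (bez (iota z + 'i%C * iota e) (iota z - 'i%C * iota e))) ->
    P.[0] = (wronskian q1 q2).[z].
  by move=> ->; rewrite rmorph0 mulr0 subr0 addr0 bezout_diag_real.
have [P1 P1E] := vertical x; have [P2 P2E] := vertical y.
have [|d1 d1_gt0 near1] := @horner_pos_near _ P1; first by rewrite (at0 x).
have [|d2 d2_gt0 near2] := @horner_pos_near _ (- P2).
  by rewrite hornerN oppr_gt0 (at0 y).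
have [rQ QE] := closed_field_poly_normal Q.
have d_gt0 : 0 < Num.min d1 d2 by rewrite lt_min d1_gt0.
have [e /andP[e0]] := exists_small_notin [seq complex.Im w | w <- rQ] d_gt0.
rewrite lt_min => /andP[ed1 ed2] enotin.
have [P PE] := bezout_real_part_poly
  ('X + ('i%C * iota e)%:P) ('X - ('i%C * iota e)%:P).
have {}PE t :
  P.[t] = complex.Re (bez (iota t + 'i%C * iota e) (iota t - 'i%C * iota e)).
  by rewrite PE !(hornerD, hornerN, hornerX, hornerC).
have Px : 0 < P.[x] by rewrite PE -P1E near1.
have Py : P.[y] < 0 by rewrite PE -P2E -oppr_gt0 -hornerN near2.
have [t Pt] : exists t, P.[t] = 0.
  have [xy|/ltW yx] := leP x y.
    have [|t _ /rootP Pt] := @polyrcf.poly_ivt _ P _ _ xy; last by exists t.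
    by rewrite nmulr_lle0 // ltW.
  have [|t _ /rootP Pt] := @polyrcf.poly_ivt _ P _ _ yx; last by exists t.
  by rewrite pmulr_lle0 // ltW.
pose u : C := iota t + 'i%C * iota e.
have uc : u^*%C = iota t - 'i%C * iota e by rewrite /u; simpc.
have imu : complex.Im u = e by rewrite /u; simpc.
have Qu : Q.[u] = 0.
  apply: balanced; first by rewrite imu gt_eqF.
  by apply: bezout_conj_eq0; rewrite uc -PE.
have : root Q u by rewrite rootE Qu.
rewrite QE rootZ ?lead_coef_eq0 // root_prod_XsubC => urQ.
by case/negP: enotin; apply/mapP; exists u.
Qed.
End WronskianSign.

Section Congruence.
Context {R : realType}.

Lemma psd_of_congruent_diag n (A V : 'M[R]_n) (d : 'rV[R]_n) :
  A^T = A -> V \in unitmx -> V^T *m A *m V = diag_mx d ->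
  (forall i, 0 <= d 0 i) -> psd A.
Proof.
move=> symA uV diagA d0; split=> // v; set w := invmx V *m v.
have -> : v = V *m w by rewrite mulKVmx.
rewrite trmx_mul -!mulmxA [A *m _]mulmxA [V^T *m _]mulmxA [V^T *m _]mulmxA diagA.
rewrite mxE sumr_ge0 // => i _; rewrite mul_diag_mx !mxE.
by rewrite mulrCA mulr_ge0 // -expr2 sqr_ge0.
Qed.

End Congruence.

(** * Real zeros give a definite Bezoutian *)

Section Necessity.
Context {R : realType}.
Local Notation C := R[i].
Local Notation iota := (real_complex R).
Local Notation "f ^C" := (map_poly iota f) (format "f ^C").
Variables (m : nat) (p : {mpoly R[2]}) (q0 q1 q2 : {poly R}).
Hypotheses (sp : msize p = m.+1) (p0 : peval p 0 = 1) (irrp : mirreducible p)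
  (s0 : (size q0 <= m.+1)%N) (s1 : (size q1 <= m.+1)%N) (s2 : (size q2 <= m.+1)%N)
  (q00 : q0 != 0) (nconst : ~ (exists a b, q1 = a *: q0 /\ q2 = b *: q0))
  (vp : vanishes_on_param q0 q1 q2 p).

(** Q collects the parameters of points at infinity, those of the lines whose
    line polynomial has degree less than m or a multiple root, and the zeros of
    the radial derivative, among which euler_at_conjugate_pair puts every other
    nonreal u at which q1 / q2 is real. *)
Lemma finitely_many_balanced : real_zero p -> exists2 Q : {poly C}, Q != 0 &
  forall u : C, complex.Im u != 0 ->
    complex.Im (q1^C.[u] * (q2^C.[u])^*%C) = 0 -> Q.[u] = 0.
Proof.
move=> rz.
have m_gt0 := degree_gt0 sp irrp.
have [top noc] := top_and_no_common_root sp p0 irrp s0 s1 s2 q00 nconst vp.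
have linen0 := line_poly_neq0 m_gt0 top noc.
have W0 := wronskian_neq0 m_gt0 top noc.
have [rW WE] := closed_field_poly_normal (wronskian q1 q2)^C.
have H0 : homogenize q0 q1 q2 (euler p) != 0.
  apply/eqP => /vanishes_on_param_homogenize -/(_ q00).
  exact: euler_nvanishes irrp p0 q00 nconst vp.
exists (q0^C * line_poly q1 q2 (iota q1`_m) (iota q2`_m) *
  (\prod_(w <- rW) line_poly q1 q2 q1^C.[w] q2^C.[w]) *
  (homogenize q0 q1 q2 (euler p))^C).
  rewrite !mulf_neq0 ?map_poly_eq0 //; first by apply: linen0; rewrite !fmorph_eq0.
  by rewrite prodf_seq_neq0; apply/allP => w _; rewrite /= linen0.
move=> u imu bal; apply/eqP; apply/negPn/negP.
rewrite !hornerM !mulf_eq0 !negb_or horner_prod prodf_seq_neq0.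
move=> /andP[/andP[/andP[q0u leadu] /allP Wu] Hu].
have [z z0 [s [q1u q2u]]] := real_ratio bal (noc u).
move/eqP: Hu; apply; apply: (euler_at_conjugate_pair sp p0 irrp s0 s1 s2 q00 nconst vp
  rz z0 imu q0u q1u q2u).
  apply: contra leadu => /eqP e; rewrite line_polyE q1u q2u.
  have -> : iota q2`_m * (s * iota (z 0 0)) - iota q1`_m * (s * iota (z 0 1)) =
    - (s * (iota (z 0 1) * iota q1`_m - iota (z 0 0) * iota q2`_m)) by ring.
  by rewrite e mulr0 oppr0.
move=> w; rewrite rootE line_polyE => /eqP fw; apply/negP => Ww.
have wW : w \in rW.
  move: Ww; rewrite -rootE WE rootZ ?lead_coef_eq0 ?map_poly_eq0 //.
  by rewrite root_prod_XsubC.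
have := Wu w wW; rewrite /= line_polyE q1u q2u.
have -> : q2^C.[w] * (s * iota (z 0 0)) - q1^C.[w] * (s * iota (z 0 1)) =
  - (s * (iota (z 0 1) * q1^C.[w] - iota (z 0 0) * q2^C.[w])) by ring.
by rewrite fw mulr0 oppr0 eqxx.
Qed.

(** On a line avoiding the exceptional parameters all roots are real and distinct,
    and their real Vandermonde matrix turns the Bezoutian into the diagonal matrix
    of the values of the Wronskian. *)
Lemma psd_of_real_zero : real_zero p ->
  psd (bezoutian m q1 q2) \/ psd (- bezoutian m q1 q2).
Proof.
move=> rz; have [Q Q0 bal] := finitely_many_balanced rz.
have m_gt0 := degree_gt0 sp irrp.
have [top noc] := top_and_no_common_root sp p0 irrp s0 s1 s2 q00 nconst vp.
have [rQ QE] := closed_field_poly_normal Q.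
have [v] := exists_generic_direction m_gt0 top noc rQ.
set z1 := q1.[v]; set z2 := q2.[v] => -[z0 lead good].
have [w /good[]//|a inja rts] := generic_line_roots s1 s2 z0 lead.
have aroot i : root (line_poly q1 q2 (iota z1) (iota z2)) (a 0 i).
  by apply/rts; exists i.
have cross i : q1^C.[a 0 i] * iota z2 = q2^C.[a 0 i] * iota z1.
  have := aroot i; rewrite rootE line_polyE subr_eq0 mulrC.
  by rewrite [X in _ == X]mulrC => /eqP.
have ima i : complex.Im (a 0 i) = 0.
  apply/eqP; apply/negPn/negP => imi; have [_ /negP] := good _ (aroot i); apply.
  suff : root Q (a 0 i) by rewrite QE rootZ ?lead_coef_eq0 // root_prod_XsubC.
  rewrite rootE bal //; have [s [-> ->]] := colinear z0 (cross i).
  by case: (s) => x y; simpc => /=; ring.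
pose r := map_mx (@complex.Re R) a.
have aE i : a 0 i = iota (r 0 i).
  by rewrite mxE; have := ima i; case: (a 0 i) => x y /= ->.
have injr : injective (r 0) by move=> i j rij; apply: inja; rewrite !aE rij.
have crossr i : q1.[r 0 i] * z2 = q2.[r 0 i] * z1.
  by have := cross i; rewrite !aE !horner_map -!rmorphM => /complexI.
have uV : Vandermonde m r \in unitmx.
  by rewrite unitmxE unitfE det_Vandermonde_neq0.
have zr0 : (z1 != 0) || (z2 != 0) by move: z0; rewrite !fmorph_eq0.
have diagB : (Vandermonde m r)^T *m bezoutian m q1 q2 *m Vandermonde m r =
    diag_mx (\row_i (wronskian q1 q2).[r 0 i]).
  have BE : bezoutian m q1 q2 = map_mx idfun (bezoutian m q1 q2).
    by apply/matrixP => i j; rewrite [RHS]mxE.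
  apply/matrixP => i j; rewrite {1}BE (Vandermonde_bezoutian idfun r i j s1 s2).
  rewrite [RHS]mxE [in RHS]mxE; have [->|nij] := eqVneq i j.
    by rewrite bezout_at_diag map_poly_id.
  have rij : r 0 i - r 0 j != 0.
    by rewrite subr_eq0; apply: contra nij => /eqP /injr ->.
  apply: (mulIf rij); rewrite bezout_at_offdiag !map_poly_id //.
  have [s [-> ->]] := colinear zr0 (crossr i).
  have [s' [-> ->]] := colinear zr0 (crossr j).
  by rewrite mulr0n; ring.
have := wronskian_sign_constant s1 s2 Q0 bal; case=> W; [left|right].
  apply: (psd_of_congruent_diag _ uV diagB); first exact: trmx_bezoutian.
  by move=> i; rewrite mxE.
apply: (psd_of_congruent_diag (d := - \row_i (wronskian q1 q2).[r 0 i]) _ uV).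
- by rewrite linearN /= trmx_bezoutian.
- by rewrite mulmxN mulNmx diagB linearN.
- by move=> i; rewrite !mxE oppr_ge0.
Qed.

End Necessity.

(** The Wronskian is the value of the quadratic form at (1, u, ..., u^(m-1)). *)
Lemma wronskian_le0_of_psd_opp (R : realType) m (q1 q2 : {poly R}) u :
  (size q1 <= m.+1)%N -> (size q2 <= m.+1)%N ->
  psd (- bezoutian m q1 q2) -> (wronskian q1 q2).[u] <= 0.
Proof.
move=> s1 s2 [_ /(_ (Vandermonde m (const_mx u : 'rV_1)))].
have BE : bezoutian m q1 q2 = map_mx idfun (bezoutian m q1 q2).
  by apply/matrixP => i j; rewrite [RHS]mxE.
rewrite mulmxN mulNmx mxE {1}BE (Vandermonde_bezoutian idfun _ _ _ s1 s2).
by rewrite bezout_at_diag map_poly_id // mxE oppr_ge0.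
Qed.

Theorem lemma4 (R : realType) (m : nat) (p : {mpoly R[2]})
    (q0 q1 q2 : {poly R}) :
  msize p = m.+1 ->
  peval p 0 = 1 ->
  mirreducible p ->
  (size q0 <= m.+1)%N -> (size q1 <= m.+1)%N -> (size q2 <= m.+1)%N ->
  rational_parametrization p q0 q1 q2 ->
  (clockwise q1 q2 ->
     (rigidly_convex p (origin_component p) <-> psd (bezoutian m q1 q2)))
  /\ (rigidly_convex p (origin_component p) <->
        psd (bezoutian m q1 q2) \/ psd (- bezoutian m q1 q2)).
Proof.
move=> sp p0 irrp s0 s1 s2 [q00 nconst im _].
have vp : vanishes_on_param q0 q1 q2 p by move=> u q0u; apply: im; exists u.
have main : rigidly_convex p (origin_component p) <->
    psd (bezoutian m q1 q2) \/ psd (- bezoutian m q1 q2).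
  split=> [[_]|psdB].
    exact: psd_of_real_zero sp p0 irrp s0 s1 s2 q00 nconst vp.
  by split=> //; exact: real_zero_of_psd sp p0 irrp s0 s1 s2 q00 nconst vp psdB.
split=> // -[u cw]; rewrite main; split=> [[//|nB]|]; last by left.
by move: cw; rewrite ltNge (wronskian_le0_of_psd_opp u s1 s2 nB).
Qed.
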